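(* Assume $-y\ge r/(4c)$. Let $\bar\alpha_{\beta_0}$ be the $\beta_0$-barrier strategy in the hitting time game. For every $x\in[0,D]$ one has $$g(x)=\bar J(x,\bar\alpha_{\beta_0}),\qquad\text{where}\quad \bar J(x,\bar\alpha):=\sup_{\psi\in\mathcal{Q}[x,\bar\alpha]}\bar c(x,\psi,\bar\alpha[\psi]).$$
   Context: Fixed data: constants $D>0$, $r>0$, $c_1>0$, $c_2>0$, $y\in\mathbb{R}$; $c:=(c_1^{-1}+c_2^{-1})^{-1}$; and a continuous, strictly increasing function $h:[0,D]\to[0,\infty)$ with $h(0)=0$. Let $\mathcal{P}$ be the set of continuous functions $[0,\infty)\to\mathbb{R}$ starting at $0$, and $\mathcal{E}$ the set of nondecreasing right-continuous functions with left limits $[0,\infty)\to[0,\infty)$ (a positive value at time $0$ is allowed and is regarded as a jump at time $0$). For $T\ge0$ and $\psi=(\psi^1,\psi^2)\in\mathcal{P}^2$ let $\mathbb{I}(T,\psi)=\int_0^T\big[c_1(\dot\psi^1(s))^2+c_2(\dot\psi^2(s))^2\big]ds$ if $\psi^1,\psi^2$ are absolutely continuous on $[0,T]$, and $\mathbb{I}(T,\psi)=+\infty$ otherwise. Hitting time game. Given $x\in[0,D]$, $\psi\in\mathcal{P}^2$, $\varrho\in\mathcal{E}$, the dynamics are $\varphi_{x,\psi,\varrho}(t)=x+yt+\psi^1(t)-\psi^2(t)-\varrho(t)$, $t\ge0$, and $\tau(x,\psi,\varrho)=\inf\{t\ge0:\varphi_{x,\psi,\varrho}(t)=0\}$ ($\inf\emptyset=\infty$).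 A strategy is a map $\bar\alpha:\mathcal{P}^2\to\mathcal{E}$ that is causal: for every $t\ge0$, if $\psi=\tilde\psi$ on $[0,t]$ then $\bar\alpha[\psi]=\bar\alpha[\tilde\psi]$ on $[0,t]$. Let $\bar{\mathcal{A}}_x$ be the set of strategies such that for every $\psi\in\mathcal{P}^2$, with $\varrho=\bar\alpha[\psi]$, one has $\varphi_{x,\psi,\varrho}(t)\in[0,D]$ for all finite $t\in[0,\tau(x,\psi,\varrho)]$. Let $\mathcal{Q}[x,\bar\alpha]=\{\psi\in\mathcal{P}^2:\tau(x,\psi,\bar\alpha[\psi])<\infty\}$. For $\psi\in\mathcal{Q}[x,\bar\alpha]$ set, with $\tau=\tau(x,\psi,\bar\alpha[\psi])$ and $\varphi=\varphi_{x,\psi,\bar\alpha[\psi]}$, $$\bar c(x,\psi,\bar\alpha[\psi])=\int_0^\tau h(\varphi(t))\,dt+r\,\bar\alpha[\psi](\tau)-\mathbb{I}(\tau,\psi).$$ Skorohod map. For $a<b$, $\Gamma_{[a,b]}$ maps a right-continuous path with left limits $\omega:[0,\infty)\to\mathbb{R}$ to the unique triplet $(\varphi,\eta_1,\eta_2)$ such that $\varphi=\omega+\eta_1-\eta_2$, $\varphi(t)\in[a,b]$ for all $t$, $\eta_1,\eta_2$ are nonnegative and nondecreasing with $\eta_i(0-)=0$ (a positive value $\eta_i(0)$ is regarded as a jump at $0$), and $\int_{[0,\infty)}1_{(a,b]}(\varphi)\,d\eta_1=\int_{[0,\infty)}1_{[a,b)}(\varphi)\,d\eta_2=0$. Barrier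 strategy. For $\beta\in(0,D]$, the $\beta$-barrier strategy $\bar\alpha_\beta\in\bar{\mathcal{A}}_x$ is the strategy for which, for every $\psi\in\mathcal{Q}[x,\bar\alpha_\beta]$, $(\varphi,0,\bar\alpha_\beta[\psi])=\Gamma_{[0,\beta]}(x+y\cdot+\psi^1-\psi^2)$ on $[0,\tau]$ (values after $\tau$ are irrelevant). For $\beta=0$ it is the strategy with $\bar\alpha_0[\psi](0)=x$, so that $\tau=0$. The function $g$. Under $-y\ge r/(4c)$ define $$\beta_0=\begin{cases}h^{-1}\big(-\tfrac{r^2}{4c}-ry\big), & -h(D)\le \tfrac{r^2}{4c}+ry\le 0,\\ D, & \tfrac{r^2}{4c}+ry<-h(D),\end{cases}$$ and $g:[0,D]\to\mathbb{R}$ by $$g(x)=\int_0^x2c\Big(-y-\sqrt{y^2-h(u)/c}\Big)du\ \ (0\le x\le\beta_0),\qquad g(x)=g(\beta_0)+r(x-\beta_0)\ \ (\beta_0<x\le D).$$ (One has $y^2-h(u)/c\ge0$ for $u\in[0,\beta_0]$.) *)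

(* Defs.v *)
From HB Require Import structures.
From mathcomp Require Import all_boot all_order all_algebra.
From mathcomp Require Import all_classical all_reals all_analysis.

Set Implicit Arguments.
Unset Strict Implicit.
Unset Printing Implicit Defensive.

Import Order.TTheory GRing.Theory Num.Theory.
Import numFieldNormedType.Exports.

Local Open Scope classical_set_scope.
Local Open Scope ring_scope.

(* A path on [0, +oo) is represented by a total function R -> R. Every notion
   below depends only on its values on [0, +oo): the values at negative times
   are never constrained, except that the increasing parts of the Skorohod
   decomposition are extended by 0. *)

Section Paths.
Context {R : realType}.
Implicit Types (f w : R -> R) (psi : (R -> R) * (R -> R)).

Definition cadlag f : Prop :=
  (forall t : R, 0 <= t -> f x @[x --> t^'+] --> f t) /\
  (forall t : R, 0 < t -> cvg (f x @[x --> t^'-])).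

Definition cont_paths : set (R -> R) :=
  [set f | {within `[(0 : R), +oo[, continuous f} /\ f 0 = 0].

Definition cont_paths2 : set ((R -> R) * (R -> R)) :=
  [set psi | cont_paths psi.1 /\ cont_paths psi.2].

Definition incr_paths : set (R -> R) :=
  [set f | [/\ forall t : R, 0 <= t -> 0 <= f t,
               forall s t : R, 0 <= s -> s <= t -> f s <= f t
             & cadlag f]].

Definition abs_continuous (a b : R) f : Prop :=
  forall e : R, 0 < e -> exists2 d : R, 0 < d &
    forall (n : nat) (u v : 'I_n -> R),
      (forall i, [/\ a <= u i, u i <= v i & v i <= b]) ->
      trivIset [set: 'I_n] (fun i => `]u i, v i[%classic) ->
      \sum_(i < n) (v i - u i) < d ->
      \sum_(i < n) `|f (v i) - f (u i)| < e.

(* An absolutely continuous function is differentiable almost everywhere, so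
   the junk value of derive1 at the other points does not matter. *)
Definition energy (c1 c2 T : R) psi : \bar R :=
  if `[< abs_continuous 0 T psi.1 /\ abs_continuous 0 T psi.2 >] then
    (\int[lebesgue_measure]_(s in `[0%R, T])
       (c1 * (derive1 psi.1 s) ^+ 2 + c2 * (derive1 psi.2 s) ^+ 2)%:E)%E
  else +oo%E.

(* skorohod a b w phi eta1 eta2 : (phi, eta1, eta2) is the image of w under the
   Skorohod map on [a, b]. As eta1 and eta2 are nondecreasing, right-continuous
   and extended by 0 to negative times, they are nonnegative, and their
   Lebesgue-Stieltjes measures have mass eta1 0 and eta2 0 at time 0. *)
Definition skorohod (a b : R) w (phi : R -> R) (eta1 eta2 : cumulative R R)
    : Prop :=
  [/\ forall t : R, t < 0 -> eta1 t = 0 /\ eta2 t = 0,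
      forall t : R, 0 <= t -> phi t = w t + eta1 t - eta2 t,
      forall t : R, 0 <= t -> a <= phi t <= b,
      (\int[lebesgue_stieltjes_measure eta1]_(t in `[0%R, +oo[)
         (\1_(`]a, b] : set R) (phi t))%:E = 0)%E
    & (\int[lebesgue_stieltjes_measure eta2]_(t in `[0%R, +oo[)
         (\1_(`[a, b[ : set R) (phi t))%:E = 0)%E].

End Paths.

Section HittingTimeGame.
Context {R : realType}.
Implicit Types (x y D r c beta : R) (h rho : R -> R).
Implicit Types (psi : (R -> R) * (R -> R)).
Implicit Types (alpha : (R -> R) * (R -> R) -> R -> R).

Definition free_path y x psi : R -> R :=
  fun t => x + y * t + psi.1 t - psi.2 t.

Definition trajectory y x psi rho : R -> R :=
  fun t => free_path y x psi t - rho t.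

Definition hitting_time y x psi rho : \bar R :=
  ereal_inf [set t%:E | t in [set t | 0 <= t /\ trajectory y x psi rho t = 0]].

Definition strategy alpha : Prop :=
  (forall psi, cont_paths2 psi -> incr_paths (alpha psi)) /\
  (forall psi psi', cont_paths2 psi -> cont_paths2 psi' ->
     forall t : R, 0 <= t ->
       (forall s : R, 0 <= s <= t -> psi.1 s = psi'.1 s /\ psi.2 s = psi'.2 s) ->
       forall s : R, 0 <= s <= t -> alpha psi s = alpha psi' s).

Definition admissible D y x alpha : Prop :=
  strategy alpha /\
  forall psi, cont_paths2 psi ->
    forall t : R, 0 <= t -> (t%:E <= hitting_time y x psi (alpha psi))%E ->
      0 <= trajectory y x psi (alpha psi) t <= D.

Definition hitting_paths y x alpha : set ((R -> R) * (R -> R)) :=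
  [set psi | cont_paths2 psi /\ (hitting_time y x psi (alpha psi) < +oo)%E].

Definition game_cost r c1 c2 y h x psi rho : \bar R :=
  let T := fine (hitting_time y x psi rho) in
  (\int[lebesgue_measure]_(t in `[0%R, T]) (h (trajectory y x psi rho t))%:E
   + (r * rho T)%:E - energy c1 c2 T psi)%E.

Definition game_value r c1 c2 y h x alpha : \bar R :=
  ereal_sup [set game_cost r c1 c2 y h x psi (alpha psi)
            | psi in hitting_paths y x alpha].

(* The condition determines alpha psi up to the hitting time even when psi is
   not in hitting_paths: a path psi that has not hit by time t can be continued
   after t so that it hits (an admissible trajectory stays nonnegative until it
   hits, and psi.1 - psi.2 can be driven down), and alpha is causal. *)
Definition barrier_strategy D y x beta alpha : Prop :=
  admissible D y x alpha /\
  if beta == 0 then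
    forall psi, cont_paths2 psi -> alpha psi 0 = x
  else
    forall psi, hitting_paths y x alpha psi ->
      exists (phi : R -> R) (eta1 eta2 : cumulative R R),
        skorohod 0 beta (free_path y x psi) phi eta1 eta2 /\
        forall t : R, 0 <= t -> (t%:E <= hitting_time y x psi (alpha psi))%E ->
          [/\ trajectory y x psi (alpha psi) t = phi t,
              eta1 t = 0
            & alpha psi t = eta2 t].

Definition barrier_level D r c y h : R :=
  let q := r ^+ 2 / (4 * c) + r * y in
  if - h D <= q <= 0 then 'pinv_(fun=> 0) `[0, D] h (- q) else D.

Definition value_function D r c y h x : R :=
  let beta0 := barrier_level D r c y h in
  let g_low z := \int[lebesgue_measure]_(u in `[0, z])
      (2 * c * (- y - Num.sqrt (y ^+ 2 - h u / c))) in
  if x <= beta0 then g_low x else g_low beta0 + r * (x - beta0).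

End HittingTimeGame.

(* Main.v *)
Require Import Defs.
From HB Require Import structures.
From mathcomp Require Import all_boot all_order all_algebra.
From mathcomp Require Import all_classical all_reals all_analysis.
From mathcomp Require Import measurable_realfun.
From mathcomp Require Import ring lra.

(* Write s = sqrt(y^2 - h/c), the [speed], and p = 2 c (- y - s), the [slope];
   on [0, beta0] p is nondecreasing, 0 <= p <= r, and p solves
   p^2 / (4 c) + y p + h = 0.

   Upper bound. The energy dominates the integral of c v^2 with v = psi1' - psi2',
   hence p v - p^2 / (4 c) for every constant p on every time interval; since the
   energy is defined by pointwise derivatives, this needs the fundamental theorem
   of calculus for absolutely continuous functions, obtained from the
   Radon-Nikodym theorem applied to the total variation and from Lebesgue
   differentiation. Let V(t) be the cost accumulated up to t plus g(phi(t)).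
   While the reflection term is constant take p to be the slope at the final
   position; up to a contact with beta0 take p = r. So V increases by at most
   epsilon times the length on short intervals, whence V(T) <= V(0) = g(x).

   Lower bound. Moving with velocity - (s + d), d > 0, after the initial jump to
   min(x, beta0) never touches the barrier again, reaches 0 in finite time, and
   loses at most c d D against g(x). *)

Import Order.TTheory GRing.Theory Num.Theory.
Import numFieldNormedType.Exports.

Local Open Scope classical_set_scope.
Local Open Scope ring_scope.

(** * Absolutely continuous functions have bounded variation *)

Section AbsoluteContinuity.
Context {R : realType}.
Implicit Types (a b : R) (f : R -> R).

(** Among velocities with a - b = v the least value of c1 a^2 + c2 b^2 is c v^2, attained at a = c v
    / c1 and b = - c v / c2; this is the origin of c. The equation for p says that p (y + v) + h - c
    v^2 has maximum 0 over v. The maximum is at v = p / (2 c), that is y + v = - s, which is the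
    velocity of the lower bound before the shift by d; p is the smaller root, the one vanishing at
    position 0. No chain rule is applied to g along a path, because the reflection term is only
    known to be nondecreasing and right-continuous. Since p is nondecreasing, g is convex on
    [0, beta0], and its supporting line at the final position bounds the increment of g from above.
    The only error left is the oscillation of the running cost, and short intervals make it small.
    For the lower bound, the barrier equations are available only for paths already known to hit 0.
    The candidate path is therefore continued past its zero, down to a level where admissibility
    forces a hit. *)

Lemma abs_continuous_dist {a b f e} : abs_continuous a b f -> 0 < e ->
  exists2 d : R, 0 < d & forall u v, a <= u -> u <= v -> v <= b -> v - u < d ->
    `|f v - f u| < e.
Proof.
move=> ac e0; have [d d0 H] := ac e e0; exists d => // u v au uv vb duv.
have := H 1%N (fun=> u) (fun=> v); rewrite !big_ord1; apply => //.
by move=> i j _ _ _; rewrite (ord1 i) (ord1 j).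
Qed.

Lemma bounded_variation_cat {a b} (c : R) {f} : a <= c -> c <= b ->
  bounded_variation a c f -> bounded_variation c b f -> bounded_variation a b f.
Proof.
move=> ac cb /(bounded_variationP _ ac) h1 /(bounded_variationP _ cb) h2.
apply/(bounded_variationP _ (le_trans ac cb)).
by rewrite (total_variationD f ac cb) fin_numD h1.
Qed.

(** The grid points are [nth b (a :: p) i], so [nth b p i] is the next point and cell i lies between
    the two. All sums over cells use this indexing. *)
Lemma nth_cons_itv_partition {a b : R} {p : seq R} : itv_partition a b p ->
  (forall i j, (i <= j)%N -> (j <= size p)%N -> nth b (a :: p) i <= nth b (a :: p) j).
Proof.
move=> [pa /eqP pb] i j ij jp.
have := @sorted_leq_nth _ <=%R le_trans lexx b (a :: p).
rewrite /= => /(_ (sub_path (@ltW _ _) pa)) /(_ i j); apply => //.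
by rewrite inE /=  ltnS (leq_trans ij).
Qed.

Lemma trivIset_itv_partition {a b : R} {p : seq R} (s : nat -> R) :
  itv_partition a b p ->
  (forall i, s i <= nth b p i) ->
  trivIset [set: 'I_(size p)] (fun i => `]nth b (a :: p) i, s i[%classic).
Proof.
move=> abp sp i j _ _ [z [/=]]; rewrite !in_itv/= => /andP[iz zi] /andP[jz zj].
apply/val_inj => /=; case: (ltngtP i j) => // lt; exfalso.
- have := nth_cons_itv_partition abp i.+1 j lt (ltnW (ltn_ord j)).
  rewrite /= => h; have := lt_trans jz (lt_le_trans zi (le_trans (sp i) h)).
  by rewrite ltxx.
- have := nth_cons_itv_partition abp j.+1 i lt (ltnW (ltn_ord i)).
  rewrite /= => h; have := lt_trans iz (lt_le_trans zj (le_trans (sp j) h)).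
  by rewrite ltxx.
Qed.

Lemma variation_ord a b f p : variation a b f p =
  \sum_(i < size p) `|f (nth b p i) - f (nth b (a :: p) i)|.
Proof. by rewrite /variation big_mkord. Qed.

(** On an interval shorter than the modulus d for error 1, the sum over any partition stays below 1.
    Finitely many such intervals make up [[a, b]], and bounded variation survives concatenation. *)
Lemma abs_continuous_BV {a b f} : a <= b -> abs_continuous a b f ->
  bounded_variation a b f.
Proof.
move=> ab ac; have [d d0 H] := ac 1 ltr01.
have small u v : a <= u -> u <= v -> v <= b -> v - u < d -> bounded_variation u v f.
  move=> au uv vb duv; exists 1 => _ [s us <-]; rewrite variation_ord.
  apply/ltW; apply: H.
  - move=> i; split.
    + by apply: le_trans au _; rewrite itv_partition_nth_ge// ltnS ltnW.
    + by have := nth_cons_itv_partition us i i.+1 (leqnSn _) (ltn_ord i).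
    + by apply: le_trans vb; apply: (@itv_partition_nth_le _ _ u v s i.+1) => //; exact: ltn_ord.
  - by apply: (trivIset_itv_partition (fun i => nth v s i) us).
  - suff -> : \sum_(i < size s) (nth v s i - nth v (u :: s) i) = v - u by [].
    rewrite -(big_mkord xpredT (fun i => nth v (u :: s) i.+1 - nth v (u :: s) i)).
    by rewrite telescope_sumr// (itv_partition_nth_size v us).
pose N := (Num.truncn ((b - a) / d)).+1.
have N0 : 0 < N%:R :> R by rewrite ltr0n.
have dN : (b - a) / N%:R < d.
  rewrite ltr_pdivrMr// mulrC -ltr_pdivrMr//.
  by rewrite truncnS_gt.
pose t k := a + k%:R * ((b - a) / N%:R).
have st : 0 <= (b - a) / N%:R by rewrite divr_ge0 ?subr_ge0// ltW.
have tN : t N = b by rewrite /t mulrCA divff ?gt_eqF// mulr1; ring.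
have tm k l : (k <= l)%N -> t k <= t l.
  by move=> kl; rewrite lerD2l ler_wpM2r// ler_nat.
have t0 : t 0%N = a by rewrite /t mul0r addr0.
suff H2 k : (k <= N)%N -> bounded_variation a (t k) f by rewrite -tN; exact: H2.
elim: k => [_|k ih kN]; first by rewrite t0; exact: bounded_variationxx.
apply: (bounded_variation_cat (t k)).
- by rewrite -{1}t0 tm.
- by rewrite tm.
- by apply: ih; exact: ltnW.
- apply: small; rewrite ?tm//; first by rewrite -{1}t0 tm.
    by rewrite -tN tm.
  by rewrite /t -natr1; apply: le_lt_trans dN; rewrite mulrDl mul1r; lra.
Qed.

End AbsoluteContinuity.

(** * Stieltjes measures dominated by Lebesgue measure *)

Section Dominates.
Context {R : realType}.
Implicit Types (a b : R) (f : R -> R).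

(** The points of [q] are inserted one at a time. With the endpoints of a finite cover in [q], each
    interval of the cover becomes a union of cells inside []a, b]]. *)
Lemma itv_partition_refine {a b : R} {s} (q : seq R) : itv_partition a b s ->
  exists p, [/\ itv_partition a b p, subseq s p &
    forall x, x \in q -> a < x < b -> x \in p].
Proof.
move=> abs; elim: q => [|c q [p [abp sp qp]]]; first by exists s; split.
have [/andP[ac cb]|abc] := boolP (a < c < b); last first.
  exists p; split => // x; rewrite inE => /orP[/eqP ->|]; last exact: qp.
  by rewrite (negbTE abc).
have [cp|cp] := boolP (c \in p).
  by exists p; split => // x; rewrite inE => /orP[/eqP -> _//|]; exact: qp.
have sop : sorted <%O p by apply: path_sorted; case: abp => + _; exact.
have pE := notin_itv_partition _ cp.
have sub : subseq p (itv_partitionL p c ++ itv_partitionR p c).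
  rewrite {1}pE//; apply: cat_subseq => //.
  exact: subseq_rcons.
exists (itv_partitionL p c ++ itv_partitionR p c); split.
- exact: itv_partition_cat (itv_partitionLP ac cb abp) (itv_partitionRP ac cb abp).
- exact: subseq_trans sp sub.
- move=> x; rewrite inE => /orP[/eqP -> _|xq xab].
    by rewrite mem_cat mem_rcons inE eqxx.
  by apply: (mem_subseq sub); exact: qp.
Qed.

Lemma lebesgue_stieltjes_measure_oc (G : cumulative R R) u v : u <= v ->
  lebesgue_stieltjes_measure G `]u, v]%classic = (G v - G u)%:E.
Proof.
move=> uv; rewrite /lebesgue_stieltjes_measure /measure_extension.
by rewrite measurable_mu_extE/=; [rewrite wlength_itv_bnd|exact: is_ocitv].
Qed.

(** No grid point lies strictly inside a cell, so neither x nor y does; a cell that meets []x, y]]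
    cannot leave it. *)
Lemma grid_atom {a b : R} {p : seq R} {x y : R} {i} : itv_partition a b p ->
  (a < x < b -> x \in p) -> (a < y < b -> y \in p) -> (i < size p)%N ->
  `]nth b (a :: p) i, nth b p i] `<=` `]x, y]%classic \/
  `]nth b (a :: p) i, nth b p i] `&` `]x, y] = set0.
Proof.
move=> abp xp yp ip.
have bounds j : (j <= size p)%N -> a <= nth b (a :: p) j <= b.
  by move=> jp; rewrite itv_partition_nth_ge// itv_partition_nth_le.
have gap z : (a < z < b -> z \in p) -> ~ (nth b (a :: p) i < z < nth b p i).
  move=> zp /andP[z1 z2].
  have /andP[b1 b2] := bounds i (ltnW ip).
  have /andP[b3 b4] := bounds i.+1 ip.
  have {}zp : z \in p by apply: zp; rewrite (le_lt_trans b1 z1) (lt_le_trans z2 b4).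
  have zi := zp; rewrite -index_mem in zi.
  have [ji|ij] := leqP i (index z p).
    have := nth_cons_itv_partition abp i.+1 (index z p).+1 ji zi.
    by rewrite /= nth_index// leNgt z2.
  have := nth_cons_itv_partition abp (index z p).+1 i ij (ltnW ip).
  by rewrite /= nth_index// leNgt z1.
have [->|/set0P[z [/=]]] := eqVneq (`]nth b (a :: p) i, nth b p i] `&` `]x, y]) set0.
  by right.
rewrite !in_itv/= => /andP[iz zi] /andP[xz zy]; left => t /=.
rewrite !in_itv/= => /andP[it ti]; apply/andP; split.
  rewrite (le_lt_trans _ it)// leNgt; apply/negP => ix.
  by apply: (gap x xp); rewrite ix (lt_le_trans xz zi).
rewrite (le_trans ti)// leNgt; apply/negP => yi.
by apply: (gap y yp); rewrite yi (lt_le_trans iz zy).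
Qed.

Lemma bounded_variation_near {a b f e} : a < b -> bounded_variation a b f ->
  0 < e -> exists2 s, itv_partition a b s &
    fine (total_variation a b f) - e < variation a b f s.
Proof.
move=> ab /(bounded_variationP _ (ltW ab)) fin e0.
have [_ [_ [s abs <-] <-] h] := @ub_ereal_sup_adherent R _ e e0 fin.
exists s => //; rewrite -lte_fin EFinB fineK//.
Qed.

(* On a grid refining a partition s whose variation is within e of the total
   variation, the increments of the total variation exceed those of f by at
   most e in total; the cells inside W are controlled by absolute continuity. *)
Lemma finite_cover_stieltjes {a b f} {G : cumulative R R} {d e : R} : a < b ->
  bounded_variation a b f ->
  0 < e ->
  (forall (n : nat) (u v : 'I_n -> R),
      (forall i, [/\ a <= u i, u i <= v i & v i <= b]) ->
      trivIset [set: 'I_n] (fun i => `]u i, v i[%classic) ->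
      \sum_(i < n) (v i - u i) < d ->
      \sum_(i < n) `|f (v i) - f (u i)| < e) ->
  (forall u v, a <= u -> u <= v -> v <= b ->
     G v - G u <= 2 * (fine (total_variation a v f) - fine (total_variation a u f))) ->
  forall n (x y : nat -> R),
  let W := \big[setU/set0]_(k < n) `]x k, y k]%classic in
  (lebesgue_measure W < d%:E)%E ->
  (lebesgue_stieltjes_measure G (W `&` `]a, b]%classic) <= (4 * e)%:E)%E.
Proof.
move=> ab bv e0 H HG n x y W Wd.
pose V t := fine (total_variation a t f).
have [s abs Vs] := bounded_variation_near ab bv e0.
have [p [abp sp qp]] := itv_partition_refine
  ([seq x i | i <- iota 0 n] ++ [seq y i | i <- iota 0 n]) abs.
pose A i := `]nth b (a :: p) i, nth b p i]%classic.
have mA i : measurable (A i) by exact: measurable_itv.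
have pm := nth_cons_itv_partition abp.
have bounds j : (j <= size p)%N -> a <= nth b (a :: p) j <= b.
  by move=> jp; rewrite itv_partition_nth_ge// itv_partition_nth_le.
have WA i : (i < size p)%N -> A i `<=` W \/ A i `&` W = set0.
  move=> ip.
  suff h k : (k <= n)%N ->
      A i `<=` \big[setU/set0]_(j < k) `]x j, y j]%classic \/
      A i `&` \big[setU/set0]_(j < k) `]x j, y j]%classic = set0 by exact: h.
  elim: k => [_|k ih kn]; first by rewrite big_ord0 setI0; right.
  rewrite big_ord_recr/=.
  have /(_ (ltnW kn)) [ihl|ihr] := ih; first by left => t At; left; exact: ihl.
  have xp : a < x k < b -> x k \in p.
    move=> xab; apply: qp => //; rewrite mem_cat; apply/orP; left.
    by apply/map_f; rewrite mem_iota.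
  have yp : a < y k < b -> y k \in p.
    move=> xab; apply: qp => //; rewrite mem_cat; apply/orP; right.
    by apply/map_f; rewrite mem_iota.
  have [h|h] := grid_atom abp xp yp ip.
  - by left => t At; right; exact: h.
  - by right; rewrite setIUr ihr h setU0.
pose S i := `[< A i `<=` W >].
pose B i := if S i then A i else set0.
have mB i : measurable (B i) by rewrite /B; case: ifP.
have BW i : B i `<=` W by rewrite /B; case: ifP => [/asboolP//|_ t].
have cov : W `&` `]a, b]%classic `<=` \big[setU/set0]_(i < size p) B i.
  move=> t [Wt]; rewrite /= in_itv/= => /andP[a_t tb].
  have : exists2 i, (i < size p)%N & A i t.
    have psz : nth b (a :: p) (size p) = b by exact: itv_partition_nth_size abp.
    suff h k : (k <= size p)%N -> t <= nth b (a :: p) k ->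
        exists2 i, (i < size p)%N & A i t by apply: (h (size p)); rewrite ?psz.
    elim: k => [_ /=|k ih kp tk]; first by rewrite leNgt a_t.
    have [tk'|tk'] := leP t (nth b (a :: p) k); first exact: ih (ltnW kp) tk'.
    by exists k => //; rewrite /A/= in_itv/= tk' tk.
  move=> [i ip At]; rewrite -(bigcup_mkord (size p) B); exists i => //.
  rewrite /B; case: ifP => [//|/asboolP nAW].
  have [//|AW0] := WA i ip.
  by have : set0 t by rewrite -AW0.
have mW : measurable W by apply: bigsetU_measurable => i _; exact: measurable_itv.
apply: (@le_trans _ _ (\sum_(i < size p) lebesgue_stieltjes_measure G (B i))%E).
  apply: content_subadditive => //; first by move=> k _; exact: mB.
  by have := measurableI _ _ mW (measurable_itv `]a, b]); exact.
pose u (i : nat) := nth b (a :: p) i.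
(* Cells outside [W] get the degenerate interval [v i = u i], so the absolute continuity bound sees
   exactly the cells inside [W]. *)
pose v (i : nat) := if S i then nth b p i else u i.
have uv i : (i < size p)%N -> u i <= nth b p i by move=> ip; exact: (pm i i.+1 (leqnSn i) ip).
have GB (i : 'I_(size p)) : (lebesgue_stieltjes_measure G (B i) =
    (if S i then G (nth b p i) - G (u i) else 0)%:E)%E.
  rewrite /B; case: ifP => _; last by rewrite measure0.
  exact: lebesgue_stieltjes_measure_oc (uv _ (ltn_ord i)).
rewrite (eq_bigr _ (fun i _ => GB i)) sumEFin lee_fin.
have sumd : \sum_(i < size p) (v i - u i) < d.
  rewrite -lte_fin -sumEFin; apply: le_lt_trans Wd.
  rewrite (eq_bigr (fun i : 'I_(size p) => lebesgue_measure (B i))); last first.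
    move=> i _; rewrite /B /v; case: ifP => _; last by rewrite subrr measure0.
    by rewrite [RHS](lebesgue_stieltjes_measure_oc idfun) //; exact: uv.
  have mUB : measurable (\big[setU/set0]_(i < size p) B i : set R).
    by apply: bigsetU_measurable => i _; exact: mB.
  have tB : trivIset [set: 'I_(size p)] (fun i => B i).
    move=> i j _ _ [t []]; rewrite /B; case: ifP => // _ + ; case: ifP => // _.
    rewrite /A/= !in_itv/= => /andP[it ti] /andP[jt tj].
    apply/val_inj => /=; case: (ltngtP i j) => // lt; exfalso.
      have := pm i.+1 j lt (ltnW (ltn_ord j)).
      by rewrite leNgt (lt_le_trans jt ti).
    have := pm j.+1 i lt (ltnW (ltn_ord i)).
    by rewrite leNgt (lt_le_trans it tj).
  have <- : lebesgue_measure (\big[setU/set0]_(i < size p) B i : set R) =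
      (\sum_(i < size p) lebesgue_measure (B i))%E.
    exact: (@measure_semi_additive_ord _ (measurableTypeR R) R
      (@lebesgue_measure R) _ (fun i => B i) (fun i => mB i) tB mUB).
  apply: le_measure; rewrite ?inE//.
  by rewrite -(bigcup_mkord (size p) B) => t [i _ /BW].
have := H (size p) u v; set sumf := \sum_(i < size p) _.
have uvb (i : 'I_(size p)) : [/\ a <= u i, u i <= v i & v i <= b].
  have /andP[b1 b2] := bounds i (ltnW (ltn_ord i)).
  have /andP[b3 b4] := bounds i.+1 (ltn_ord i).
  by rewrite /v; case: ifP => _; split => //; exact: uv.
have tr : trivIset [set: 'I_(size p)] (fun i => `]u i, v i[%classic).
  move=> i j _ _ [t []]; rewrite /= !in_itv/= => /andP[it ti] /andP[jt tj].
  have {}ti : t < nth b p i.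
    by move: ti; rewrite /v; case: ifP => // _ /lt_le_trans; apply; exact: uv.
  have {}tj : t < nth b p j.
    by move: tj; rewrite /v; case: ifP => // _ /lt_le_trans; apply; exact: uv.
  apply/val_inj => /=; case: (ltngtP i j) => // lt; exfalso.
    have := pm i.+1 j lt (ltnW (ltn_ord j)).
    by rewrite leNgt (lt_trans jt ti).
  have := pm j.+1 i lt (ltnW (ltn_ord i)).
  by rewrite leNgt (lt_trans it tj).
move=> /(_ uvb tr sumd) sume.
have dV (i : 'I_(size p)) : `|f (nth b p i) - f (u i)| <= V (nth b p i) - V (u i).
  have /andP[b1 b2] := bounds i (ltnW (ltn_ord i)).
  have /andP[b3 b4] := bounds i.+1 (ltn_ord i).
  have fi : total_variation a (u i) f \is a fin_num.
    by apply/bounded_variationP => //; exact: bounded_variationl bv.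
  have ii : u i <= nth b p i by exact: uv.
  have fi2 : total_variation (u i) (nth b p i) f \is a fin_num.
    apply/bounded_variationP => //; apply: (bounded_variationl ii b4).
    exact: bounded_variationr bv.
  rewrite /V (total_variationD f b1 ii) fineD// addrAC subrr add0r.
  by rewrite -lee_fin fineK//; exact: total_variation_ge.
have sumV : \sum_(i < size p) (V (nth b p i) - V (u i)) <
    variation a b f p + e.
  rewrite -(big_mkord xpredT (fun i => V (nth b (a :: p) i.+1) - V (nth b (a :: p) i))).
  rewrite telescope_sumr//.
  rewrite (itv_partition_nth_size b abp) /= {2}/V total_variationxx subr0.
  rewrite -ltrBlDr; apply: lt_le_trans Vs _.
  exact: variation_subseq.
rewrite variation_ord in sumV.
(* The factor 2 comes from [HG]. The increments of f inside [W] sum to less than e, and so do the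
   excesses of V over f on all cells: together less than 4 e. *)
apply: (@le_trans _ _ (\sum_(i < size p) 2 * (`|f (v i) - f (u i)| +
   (V (nth b p i) - V (u i) - `|f (nth b p i) - f (u i)|)))).
  apply: ler_sum => i _; rewrite /v; case: ifP => _; last first.
    rewrite subrr normr0 add0r mulr_ge0// subr_ge0; exact: dV.
  rewrite subrKC; have /andP[b1 b2] := bounds i (ltnW (ltn_ord i)).
  have /andP[b3 b4] := bounds i.+1 (ltn_ord i).
  by apply: HG => //; exact: uv.
rewrite -mulr_sumr big_split/= sumrB -/sumf; lra.
Qed.

(** A countable cover of N of total length below d is exhausted by finite unions, each of mass at
    most e inside []a, b]]; continuity from below passes to the limit. *)
Lemma abs_continuous_dominates {a b f} {G : cumulative R R} : a < b ->
  abs_continuous a b f ->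
  (forall u v, a <= u -> u <= v -> v <= b ->
     G v - G u <= 2 * (fine (total_variation a v f) - fine (total_variation a u f))) ->
  forall N, measurable N -> lebesgue_measure N = 0%E ->
  lebesgue_stieltjes_measure G (N `&` `]a, b]%classic) = 0%E.
Proof.
move=> ab ac HG N mN N0; apply/eqP; rewrite eq_le measure_ge0 andbT.
apply/lee_addgt0Pr => e e0; rewrite add0e.
have e4 : 0 < e / 4 by rewrite divr_gt0.
have [d d0 H] := ac _ e4.
have bv := abs_continuous_BV (ltW ab) ac.
have [_ [F [mF NF] <-] Fd] :
  exists2 x, [set (\sum_(k <oo) wlength idfun (A k))%E | A in
      @measurable_cover _ (ocitv_type R) N] x & (x < d%:E)%E.
  (* By conversion the Lebesgue measure of N is this infimum over covers. *)
  have h : ereal_inf [set (\sum_(k <oo) wlength idfun (A k))%E | A in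
      @measurable_cover _ (ocitv_type R) N] = 0%E := N0.
  have [|x Fx xd] := @lb_ereal_inf_adherent _ [set (\sum_(k <oo) wlength idfun (A k))%E | A in
      @measurable_cover _ (ocitv_type R) N] d d0; first by rewrite h.
  by exists x => //; move: xd; rewrite h add0e.
have /choice [xy xyF] : forall k, exists xy : R * R, `]xy.1, xy.2]%classic = F k.
  by move=> k; have [z _ zF] := mF k; exists z.
have mF' k : measurable (F k : set R) by rewrite -xyF; exact: measurable_itv.
pose W n : set R := \big[setU/set0]_(k < n) F k.
have mW n : measurable (W n) by apply: bigsetU_measurable => i _.
have UW : \bigcup_k F k `<=` \bigcup_n W n.
  by move=> t [k _ Ft]; exists k.+1 => //; rewrite /W big_ord_recr; right.
have wF k : wlength idfun (F k) = lebesgue_measure (F k : set R).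
  by rewrite /lebesgue_measure /lebesgue_stieltjes_measure /measure_extension measurable_mu_extE.
have Wd n : (lebesgue_measure (W n) < d%:E)%E.
  apply: le_lt_trans Fd.
  apply: (@le_trans _ _ (\sum_(k < n) lebesgue_measure (F k : set R))%E).
    exact: (@content_subadditive _ R (measurableTypeR R) (@lebesgue_measure R) _ F n
      (fun k _ => mF' k) (mW n)).
  rewrite (eq_bigr (fun k : 'I_n => wlength idfun (F k))); last by move=> k _; rewrite wF.
  rewrite -(big_mkord xpredT (fun k => wlength idfun (F k))).
  apply: nneseries_lim_ge => k _ _; exact: wlength_ge0.
have mab : measurable (`]a, b]%classic : set R) by exact: measurable_itv.
have nd : {homo (fun n => W n `&` `]a, b]%classic) : n m / (n <= m)%N >-> (n <= m)%O}.
  move=> n m nm; apply/subsetPset; apply: setSI.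
  by rewrite /W; exact: subset_bigsetU.
have mWab n : measurable (W n `&` `]a, b]%classic) by exact: measurableI.
have mU : measurable (\bigcup_n (W n `&` `]a, b]%classic)) by exact: bigcupT_measurable.
have cv := @nondecreasing_cvg_mu _ _ _ (lebesgue_stieltjes_measure G)
  (fun n => W n `&` `]a, b]%classic) mWab
  mU nd.
apply: (@le_trans _ _ (lebesgue_stieltjes_measure G
    (\bigcup_n (W n `&` `]a, b]%classic)))).
  apply: le_measure; rewrite ?inE; first exact: measurableI.
    exact: mU.
  by rewrite -setI_bigcupl; apply: setSI; exact: subset_trans UW.
rewrite -(cvg_lim _ cv)//; apply: lime_le; first by apply/cvg_ex; eexists; exact: cv.
apply: nearW => n /=.
have -> : e = 4 * (e / 4) by field.
have WE : W n = \big[setU/set0]_(k < n) `](xy k).1, (xy k).2]%classic.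
  by apply: eq_bigr => k _; rewrite xyF.
have := finite_cover_stieltjes ab bv e4 H HG n (fun k => (xy k).1) (fun k => (xy k).2).
by rewrite /= -WE => /(_ (Wd n)).
Qed.

End Dominates.

(** * Densities of absolutely continuous functions *)

Section Density.
Context {R : realType}.
Implicit Types (a b : R) (f : R -> R).

(** Composition with this retraction turns a function continuous on [[a, b]] into one continuous on
    the whole line, as measurability and differentiation results require. *)
Definition clip a b (x : R) : R := Num.max a (Num.min x b).

Lemma clip_itv a b x : a <= b -> a <= clip a b x <= b.
Proof. by move=> ab; rewrite /clip le_max lexx /= ge_max ab /= ge_min lexx orbT. Qed.

Lemma clip_id a b x : a <= x <= b -> clip a b x = x.
Proof. by move=> /andP[ax xb]; rewrite /clip min_l// max_r. Qed.

Lemma le_clip a b x y : x <= y -> clip a b x <= clip a b y.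
Proof.
move=> xy; rewrite /clip ge_max le_max lexx /= le_max; apply/orP; right.
by rewrite le_min !ge_min xy lexx orbT.
Qed.

Lemma continuous_clip a b : continuous (clip a b).
Proof.
move=> x; apply: (@continuous_max R R (cst a) (fun x => Num.min x b)).
  exact: cst_continuous.
by apply: (@continuous_min R R id (cst b)); [move=> ?; exact: cvg_id|exact: cst_continuous].
Qed.

Lemma continuous_comp_clip {a b f} : a <= b -> {within `[a, b], continuous f} ->
  continuous (f \o clip a b).
Proof.
move=> ab /subspace_continuousP cf x.
have xab : `[a, b]%classic (clip a b x) by rewrite /= in_itv/= clip_itv.
apply: cvg_comp (cf _ xab) => S [e e0 eS].
have := @continuous_clip a b x => /cvgrPdist_lt/(_ _ e0).
apply: filterS => y yx; apply: eS => //.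
by rewrite /= in_itv/= clip_itv.
Qed.

Lemma abs_continuous_within {a b f} : a < b -> abs_continuous a b f ->
  {within `[a, b], continuous f}.
Proof.
move=> ab ac; apply/subspace_continuousP => x; rewrite /= in_itv/= => /andP[ax xb].
apply/cvgrPdist_lt => e e0; have [d d0 H] := abs_continuous_dist ac e0.
apply/nbhs_ballP; exists d => //= y; rewrite /ball/= => xyd.
rewrite in_itv/= => /andP[ay yb]; have [xy|yx] := leP x y.
  rewrite distrC; apply: H => //; apply: le_lt_trans xyd.
  by rewrite distrC ler_norm.
apply: H => //; first exact: ltW.
by apply: le_lt_trans xyd; rewrite ler_norm.
Qed.

Lemma cumulative_ex (G : R -> R) : nondecreasing G -> continuous G ->
  exists C : cumulative R R, (C : R -> R) = G.
Proof.
move=> ndG cG; pose M := isCumulative.Build R _ R G ndG (right_continuousW cG).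
pose C : cumulative R R := HB.pack G M.
by exists C.
Qed.

(* The Radon-Nikodym density of the Stieltjes measure of g. *)
Lemma dominated_density {a b f} {g : R -> R} : a < b -> abs_continuous a b f ->
  {within `[a, b], continuous g} ->
  (forall u v, a <= u -> u <= v -> v <= b -> 0 <= g v - g u) ->
  (forall u v, a <= u -> u <= v -> v <= b ->
     g v - g u <= 2 * (fine (total_variation a v f) - fine (total_variation a u f))) ->
  exists2 k : R -> R, lebesgue_measure.-integrable [set: R] (EFin \o k) &
    forall u v, a <= u -> u <= v -> v <= b ->
      g v - g u = \int[lebesgue_measure]_(t in `]u, v]) k t.
Proof.
move=> ab ac cg g0 gV.
(* Frozen outside [[a, b]], g becomes nondecreasing on the whole line. *)
have [G GE] : exists C : cumulative R R, (C : R -> R) = g \o clip a b.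
  apply: cumulative_ex; last exact: continuous_comp_clip (ltW ab) cg.
  move=> x y xy /=; rewrite -subr_ge0; apply: g0.
  - by have /andP[] := clip_itv a b x (ltW ab).
  - exact: le_clip.
  - by have /andP[] := clip_itv a b y (ltW ab).
have Gg u : a <= u -> u <= b -> G u = g u.
  by move=> au ub; rewrite GE /= clip_id// au.
have mab : @measurable _ (measurableTypeR R) `]a, b]%classic by exact: measurable_itv.
have muab : (lebesgue_stieltjes_measure G `]a, b]%classic < +oo)%E.
  by rewrite lebesgue_stieltjes_measure_oc ?ltry// ltW.
pose nu : {finite_measure set (measurableTypeR R) -> \bar R} := mfrestr mab muab.
have dom : nu `<< (@lebesgue_measure R).
  apply/null_content_dominatesP => N mN N0.
  apply: (abs_continuous_dominates ab ac) => // u v au uv vb.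
  by rewrite !Gg//; [exact: gV|exact: le_trans vb|exact: le_trans uv].
have [h [h0 hfin ih hE]] := @radon_nikodym_sigma_finite _ _ _
   (@lebesgue_measure R) nu dom.
exists (fine \o h).
  by rewrite (_ : _ \o _ = h)//; apply/funext => x /=; rewrite fineK.
move=> u v au uv vb; rewrite /Rintegral.
under eq_integral do rewrite /= fineK//.
rewrite -hE; last exact: (measurable_itv `]u, v]).
rewrite /nu/= /mfrestr /mrestr setIidl.
  by rewrite lebesgue_stieltjes_measure_oc//= !Gg// ?(le_trans au uv) ?(le_trans uv vb).
move=> t; rewrite /= !in_itv/= => /andP[ut tv].
by rewrite (le_lt_trans au ut) (le_trans tv vb).
Qed.

(** Jordan decomposition f = V - (V - f): both parts are nondecreasing, and their increments are at
    most twice those of V. Each part has a density, and k is the difference. *)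
Lemma abs_continuous_density {a b f} : a < b -> abs_continuous a b f ->
  exists k : R -> R, [/\ lebesgue_measure.-integrable [set: R] (EFin \o k),
    forall u v, a <= u -> u <= v -> v <= b ->
      f v - f u = \int[lebesgue_measure]_(t in `]u, v]) k t &
    {ae lebesgue_measure, forall t, a < t < b -> derive1 f t = k t}].
Proof.
move=> ab ac; have bv := abs_continuous_BV (ltW ab) ac.
pose V t := fine (total_variation a t f).
have cf := abs_continuous_within ab ac.
have cV : {within `[a, b], continuous V} := total_variation_continuous ab cf bv.
have dV u v : a <= u -> u <= v -> v <= b -> `|f v - f u| <= V v - V u.
  move=> au uv vb; have ub := le_trans uv vb.
  have fu : total_variation a u f \is a fin_num.
    by apply/bounded_variationP => //; exact: bounded_variationl bv.
  have fuv : total_variation u v f \is a fin_num.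
    apply/bounded_variationP => //; apply: (bounded_variationl uv vb).
    exact: bounded_variationr bv.
  rewrite /V (total_variationD f au uv) fineD// addrAC subrr add0r.
  by rewrite -lee_fin fineK//; exact: total_variation_ge.
have [||k1 ik1 k1E] := @dominated_density a b f V ab ac cV.
- by move=> u v au uv vb; apply: le_trans (dV u v au uv vb).
- move=> u v au uv vb; have := dV u v au uv vb.
  have := normr_ge0 (f v - f u); rewrite /V; lra.
have [|||k2 ik2 k2E] := @dominated_density a b f (fun t => V t - f t) ab ac.
- by move=> x; apply: cvgB; [exact: cV|exact: cf].
- move=> u v au uv vb; have := dV u v au uv vb.
  have := ler_norm (f v - f u); rewrite /V; lra.
- move=> u v au uv vb; have := dV u v au uv vb; rewrite -normrN.
  have := ler_norm (- (f v - f u)); rewrite /V; lra.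
pose k t := k1 t - k2 t.
have ik : lebesgue_measure.-integrable [set: R] (EFin \o k).
  by rewrite (_ : _ \o _ = ((EFin \o k1) \- (EFin \o k2))%E)//; exact: integrableB.
have kE u v : a <= u -> u <= v -> v <= b ->
    f v - f u = \int[lebesgue_measure]_(t in `]u, v]) k t.
  move=> au uv vb; rewrite RintegralB//.
  - by rewrite -k1E// -k2E//; lra.
  - exact: integrableS ik1.
  - exact: integrableS ik2.
exists k; split => //.
have lk : locally_integrable [set: R] k.
  by apply: open_integrable_locally => //; exact: openT.
have iky y : lebesgue_measure.-integrable `]-oo, y] (EFin \o k).
  exact: integrableS ik.
have := FTC1Ny iky lk.
apply: filterS; first exact: (ae_filter_ringOfSetsType lebesgue_measure).
move=> t [dF Fk] /andP[a_t tb].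
rewrite -Fk !derive1E.
pose F x := \int[lebesgue_measure]_(t in `]-oo, x]) k t.
(* On []a, b[] f differs from the indefinite integral F by a constant, so Lebesgue differentiation
   of F carries over to f. *)
have ntab : \near t, f t = f a - F a + F t.
  near=> s.
  have sa : a < s by near: s; exact: lt_nbhsr.
  have sb : s < b by near: s; exact: lt_nbhsl.
  have FE : F s - F a = \int[lebesgue_measure]_(x in `]a, s]) k x.
    by apply: (Rintegral_itvB (iky s)); rewrite bnd_simp// ltW.
  by rewrite -addrA [- _ + _]addrC FE -kE ?(ltW sa) ?(ltW sb)// subrKC.
rewrite (near_eq_derive _ ntab) deriveD//; first by rewrite derive_cst add0r.
Unshelve. all: by end_near. Qed.

End Density.

(** * Comparison of integrals without measurability of the larger function *)

Section LowerIntegral.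
Context d (T : measurableType d) (R : realType).
Variable mu : {measure set T -> \bar R}.

(* The integral of a nonnegative function is the supremum over the simple
   functions below it, hence monotone without measurability assumptions. *)
Lemma ge0_le_integral_lower (D : set T) (f g : T -> \bar R) :
  (forall x, D x -> 0 <= f x)%E -> (forall x, D x -> f x <= g x)%E ->
  (\int[mu]_(x in D) f x <= \int[mu]_(x in D) g x)%E.
Proof.
move=> f0 fg; have g0 x : D x -> (0 <= g x)%E.
  by move=> Dx; exact: le_trans (f0 _ Dx) (fg _ Dx).
rewrite !ge0_integralE//; apply: le_ereal_sup => _ [h hf <-]; exists h => //.
by move=> x; apply: le_trans (hf x) _; exact: lee_restrict.
Qed.

(** Cutting the measurable f to 0 on N keeps its integral and puts it below g everywhere. In the
    application g is the integrand of [energy], made of pointwise derivatives. *)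
Lemma ge0_le_integral_lower_null (D N : set T) (f g : T -> \bar R) :
  measurable D -> measurable N -> mu N = 0%E ->
  (forall x, D x -> 0 <= f x)%E -> measurable_fun D (f : T -> \bar R) ->
  (forall x, D x -> 0 <= g x)%E ->
  (forall x, D x -> ~ N x -> (f x <= g x)%E) ->
  (\int[mu]_(x in D) f x <= \int[mu]_(x in D) g x)%E.
Proof.
move=> mD mN N0 f0 mf g0 fg.
rewrite (ge0_negligible_integral mN mD mf f0 N0).
rewrite (_ : D `\` N = D `&` ~` N)// integral_mkcondr.
apply: ge0_le_integral_lower => x Dx; rewrite patchE.
  by case: ifP => // _; exact: f0.
case: ifPn => [|_]; last exact: g0.
by rewrite inE; exact: fg.
Qed.

End LowerIntegral.

(** * Lower bound for the energy on subintervals *)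

Section Energy.
Context {R : realType}.
Implicit Types (psi : (R -> R) * (R -> R)).

(** [e] is the indefinite integral of the energy density built from the densities of psi. It is
    additive over intervals, and its increments satisfy the inequality for all p at once. *)
Lemma energy_lower {c1 c2 T : R} {psi} : 0 < c1 -> 0 < c2 -> 0 < T ->
  abs_continuous 0 T psi.1 -> abs_continuous 0 T psi.2 ->
  (energy c1 c2 T psi < +oo)%E ->
  exists e : R -> R, [/\ e 0 = 0, ((e T)%:E <= energy c1 c2 T psi)%E &
    forall p u v, 0 <= u -> u <= v -> v <= T ->
      p * ((psi.1 v - psi.2 v) - (psi.1 u - psi.2 u))
        - p ^+ 2 / (4 * (c1^-1 + c2^-1)^-1) * (v - u) <= e v - e u].
Proof.
move=> c1_gt0 c2_gt0 T0 ac1 ac2; rewrite /energy asboolT//.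
set en := (X in (X < _)%E) => enoo.
have [k1 [ik1 k1E k1d]] := abs_continuous_density T0 ac1.
have [k2 [ik2 k2E k2d]] := abs_continuous_density T0 ac2.
pose q t := c1 * k1 t ^+ 2 + c2 * k2 t ^+ 2.
have q0 t : 0 <= q t.
  by rewrite addr_ge0// mulr_ge0 ?sqr_ge0// ltW.
have mq : measurable_fun [set: measurableTypeR R] q.
  have mk1 : measurable_fun [set: measurableTypeR R] k1.
    by apply/measurable_EFinP; exact: measurable_int ik1.
  have mk2 : measurable_fun [set: measurableTypeR R] k2.
    by apply/measurable_EFinP; exact: measurable_int ik2.
  by apply: measurable_funD; apply: measurable_funM => //; exact: measurable_funX.
have mT : measurable (`]0, T]%classic : set (measurableTypeR R)).
  exact: measurable_itv.
have qen : (\int[lebesgue_measure]_(t in `]0%R, T]) (q t)%:E <= en)%E.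
  rewrite integral_itv_obnd_cbnd; last first.
    by apply/measurable_funTS/measurable_EFinP.
  case: k1d k2d => N1 [mN1 N10 s1] [N2 [mN2 N20 s2]].
  have m0T : measurable ([set 0; T] : set (measurableTypeR R)).
    by apply: measurableU; exact: measurable_set1.
  have mN12 : measurable (N1 `|` N2) by exact: measurableU.
  (* The endpoints join the exceptional set because the densities are identified with derivatives
     only on the open interval. *)
  have le_int := @ge0_le_integral_lower_null _ _ R (@lebesgue_measure R) `[0, T]%classic
    ([set 0; T] `|` (N1 `|` N2)).
  apply: le_int => //.
  - exact: measurableU.
  - have N120 : lebesgue_measure (N1 `|` N2) = 0%E by rewrite measureU0.
    rewrite (measureU0 m0T mN12 N120); apply: countable_lebesgue_measure0.
    by apply: finite_set_countable; exact: finite_set2.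
  - by move=> t _; rewrite lee_fin.
  - by apply/measurable_funTS/measurable_EFinP.
  - by move=> t _; rewrite lee_fin addr_ge0// mulr_ge0 ?sqr_ge0 ?ltW.
  - move=> t t0T /not_orP[/not_orP[n0 nT] /not_orP[n1 n2]].
    have d1 : 0 < t < T -> (psi.1)^`()%classic t = k1 t.
      by apply: contrapT => h; exact: n1 (s1 _ h).
    have d2 : 0 < t < T -> (psi.2)^`()%classic t = k2 t.
      by apply: contrapT => h; exact: n2 (s2 _ h).
    move: t0T; rewrite /= in_itv/= => /andP[t0' tT'].
    have h : 0 < t < T.
      by rewrite !lt_neqAle t0' tT' !andbT eq_sym; apply/andP; split; apply/eqP.
    by rewrite d1// d2.
have iq : lebesgue_measure.-integrable `]0, T] (EFin \o q).
  apply/integrableP; split; first by apply/measurable_funTS/measurable_EFinP.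
  under eq_integral do rewrite /= ger0_norm//.
  exact: le_lt_trans enoo.
exists (fun t => \int[lebesgue_measure]_(s in `]0, t]) q s); split.
- by rewrite set_itv_ge ?bnd_simp ?ltxx// Rintegral_set0.
- rewrite /Rintegral fineK//; exact: integrable_fin_num iq.
move=> p u v u0 uv vT.
have muv : measurable (`]u, v]%classic : set (measurableTypeR R)).
  exact: measurable_itv.
have iquv : lebesgue_measure.-integrable `]u, v] (EFin \o q).
  apply: integrableS mT muv _ iq => t; rewrite /= !in_itv/= => /andP[ut tv].
  by rewrite (le_lt_trans u0 ut) (le_trans tv vT).
have iqv : lebesgue_measure.-integrable `]0, v] (EFin \o q).
  apply: integrableS mT (measurable_itv `]0, v]) _ iq => t; rewrite /= !in_itv/=.
  by move=> /andP[-> tv]; rewrite (le_trans tv vT).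
have -> : \int[lebesgue_measure]_(s in `]0, v]) q s -
    \int[lebesgue_measure]_(s in `]0, u]) q s =
    \int[lebesgue_measure]_(s in `]u, v]) q s.
  by apply: (Rintegral_itvB iqv); rewrite bnd_simp.
set K := p ^+ 2 / _.
have ik1' : lebesgue_measure.-integrable `]u, v] (EFin \o k1).
  exact: integrableS ik1.
have ik2' : lebesgue_measure.-integrable `]u, v] (EFin \o k2).
  exact: integrableS ik2.
have ik12 : lebesgue_measure.-integrable `]u, v] (EFin \o (fun t => k1 t - k2 t)).
  by have := integrableB muv ik1' ik2'.
have ik : lebesgue_measure.-integrable `]u, v] (EFin \o (fun t => p * (k1 t - k2 t))).
  by have := integrableZl muv p ik12.
have iK : lebesgue_measure.-integrable `]u, v] (EFin \o (fun t : R => K)).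
  have : lebesgue_measure.-integrable `[u, v] (EFin \o (fun t : R => K)).
    apply: continuous_compact_integrable; first exact: segment_compact.
    by apply: continuous_subspaceT; exact: cst_continuous.
  have muvc : measurable (`[u, v]%classic : set (measurableTypeR R)).
    exact: measurable_itv.
  by apply: (integrableS muvc muv); exact: subset_itv_oc_cc.
have -> : p * ((psi.1 v - psi.2 v) - (psi.1 u - psi.2 u)) - K * (v - u) =
   \int[lebesgue_measure]_(s in `]u, v]) (p * (k1 s - k2 s) - K).
  rewrite RintegralB// RintegralZl// RintegralB// -k1E// -k2E//.
  have muE := lebesgue_stieltjes_measure_oc idfun _ _ uv.
  by rewrite Rintegral_cst// [X in fine X]muE /=; ring.
apply: le_Rintegral.
- exact: muv.
- by have := integrableB muv ik iK.
- exact: iquv.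
- move=> t _; rewrite /q /K.
  (* Completing both squares leaves p^2 / (4 c1) + p^2 / (4 c2), which is p^2 / (4 c). *)
  have : 0 <= c1 * (k1 t - p / (2 * c1)) ^+ 2 + c2 * (k2 t + p / (2 * c2)) ^+ 2.
    by rewrite addr_ge0// mulr_ge0 ?sqr_ge0// ltW.
  have -> : c1 * (k1 t - p / (2 * c1)) ^+ 2 + c2 * (k2 t + p / (2 * c2)) ^+ 2 =
    c1 * k1 t ^+ 2 + c2 * k2 t ^+ 2 - (p * (k1 t - k2 t)
     - p ^+ 2 / (4 * (c1^-1 + c2^-1)^-1)); last by rewrite subr_ge0.
  field.
  by rewrite !gt_eqF// addr_gt0.
Qed.

End Energy.

(** * Growth of the Skorohod reflection term *)

Section Reflection.
Context {R : realType}.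

(* Otherwise the set where eta exceeds M, whose mass is positive, would be
   null for the measure of eta. *)
Lemma reflection_growth {beta : R} {phi : R -> R} {eta : cumulative R R} {M s t : R} :
  (forall u, u < 0 -> eta u = 0) ->
  (forall u, 0 <= u -> 0 <= phi u <= beta) ->
  (\int[lebesgue_stieltjes_measure eta]_(u in `[0%R, +oo[)
         (\1_(`[0, beta[ : set R) (phi u))%:E = 0)%E ->
  0 <= M -> s <= t -> eta s <= M -> M < eta t ->
  exists v, [/\ s < v, v <= t, 0 <= v, M < eta v & phi v = beta].
Proof.
move=> eta0 phiI null M0 st sM Mt; apply: contrapT => noV.
have ndeta := cumulative_is_nondecreasing eta.
(* Without a contact, phi < beta on such a set [A], so [A] lies in the set that [null] makes
   negligible. *)
have sub A : measurable (A : set (measurableTypeR R)) ->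
    (forall v, A v -> [/\ s < v, v <= t & M < eta v]) ->
    lebesgue_stieltjes_measure eta A = 0%E.
  move=> mA HA; apply/eqP; rewrite eq_le measure_ge0 andbT -null.
  have A0 v : A v -> 0 <= v.
    move=> /HA[_ _]; apply: contraTT; rewrite -ltNge -leNgt => /eta0 ->.
    exact: M0.
  have AI : A `<=` `[0, +oo[ by move=> v /A0; rewrite /= in_itv/= andbT.
  have <- : (\int[lebesgue_stieltjes_measure eta]_(x in `[0%R, +oo[) (\1_A x)%:E =
      lebesgue_stieltjes_measure eta A)%E.
    by rewrite integral_indic ?setIidl//; exact: measurable_itv.
  apply: ge0_le_integral_lower => v v0; rewrite lee_fin !indicE//.
  case: (boolP (v \in A)) => [|_]; last by rewrite ler0n.
  rewrite inE => Av; rewrite (mem_set (_ : `[0, beta[%classic (phi v)))//.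
  have [sv vt Mv] := HA _ Av.
  have /andP[p0 pb] := phiI v (A0 _ Av); rewrite /= in_itv/= p0 lt_neqAle pb andbT.
  by apply/eqP => pE; apply: noV; exists v; split => //; exact: A0.
pose N := [set v | v <= t /\ eta v <= M].
have Ns : N s by [].
have Nt : ubound N t by move=> v [].
pose u := sup N.
have supN : has_sup N by split; [exists s|exists t].
have su : s <= u by apply: ub_le_sup => //; exists t.
have ut : u <= t by apply: ge_sup => //; exists s.
have above v : u < v -> v <= t -> M < eta v.
  move=> uv vt; rewrite ltNge; apply/negP => vM.
  by move: uv; rewrite ltNge => /negP; apply; apply: ub_le_sup => //; exists t.
have below v : v < u -> eta v <= M.
  rewrite -subr_gt0 => vu; have [w [_ wM] vw] := sup_adherent vu supN.
  by apply: le_trans wM; apply: ndeta; move: vw; rewrite -/u; lra.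
have [uM|Mu] := leP (eta u) M.
  have := sub `]u, t]%classic (measurable_itv _).
  rewrite lebesgue_stieltjes_measure_oc// => h.
  have : (eta t - eta u)%:E = 0%E :> \bar R.
    apply: h => v; rewrite /= in_itv/= => /andP[uv vt].
    by split => //; [exact: le_lt_trans uv|exact: above].
  by move=> [] /eqP; rewrite subr_eq0 => /eqP tu; move: Mt; rewrite tu ltNge uM.
(* Here eta jumps across M at u: it is at most M before u, so the atom at u has mass at least
   [eta u - M], against [sub]. *)
have su' : s < u.
  by rewrite lt_neqAle su andbT; apply: contraTneq Mu => <-; rewrite -leNgt.
have mu0 : lebesgue_stieltjes_measure eta [set u] = 0%E.
  by apply: sub; [exact: measurable_set1|move=> v ->].
pose F n : set (measurableTypeR R) := `]u - n.+1%:R^-1, u]%classic.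
have FI : \bigcap_n F n = [set u] by rewrite set1_bigcap_oc.
have mF n : measurable (F n).
  exact: measurable_itv.
have gap n : ((eta u - M)%:E <= lebesgue_stieltjes_measure eta (F n))%E.
  rewrite lebesgue_stieltjes_measure_oc; last by rewrite gerBl invr_ge0.
  by rewrite lee_fin lerD2l lerN2; apply: below; rewrite gtrBl invr_gt0.
have : ((eta u - M)%:E <= 0)%E.
  have F0 : (lebesgue_stieltjes_measure eta (F 0%N) < +oo)%E.
    by rewrite lebesgue_stieltjes_measure_oc ?ltry// gerBl invr_ge0.
  have mI : measurable (\bigcap_n F n).
    by rewrite FI; exact: measurable_set1.
  have ni : nonincreasing_seq F.
    move=> n m nm; apply/subsetPset; apply: subset_itvr; rewrite bnd_simp.
    by rewrite lerD2l lerN2 lef_pV2 ?posrE// ler_nat.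
  have cvg0 := @nonincreasing_cvg_mu _ _ _ (lebesgue_stieltjes_measure eta) F F0 mF mI ni.
  have bI : lebesgue_stieltjes_measure eta (\bigcap_n F n) = 0%E by rewrite FI; exact: mu0.
  rewrite -bI.
  rewrite -(cvg_lim _ cvg0)//; apply: lime_ge; first by apply/cvg_ex; eexists; exact: cvg0.
  exact: nearW.
by rewrite lee_fin subr_le0 leNgt Mu.
Qed.

(* Either eta has stopped growing at a maximum point of w, which is then a
   contact point, or it grows above the level forced by w. *)
Lemma reflection_contact {beta : R} {phi w : R -> R} {eta : cumulative R R} {s t : R} :
  (forall u, u < 0 -> eta u = 0) ->
  (forall u, 0 <= u -> 0 <= phi u <= beta) ->
  (\int[lebesgue_stieltjes_measure eta]_(u in `[0%R, +oo[)
         (\1_(`[0, beta[ : set R) (phi u))%:E = 0)%E ->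
  0 <= s -> s <= t -> {within `[s, t], continuous w} ->
  (forall u, s <= u <= t -> phi u = w u - eta u) ->
  eta s < eta t ->
  exists u, [/\ s <= u, u <= t, phi u = beta & eta u = eta t].
Proof.
move=> eta0 phiI null s0 st cw phiE est.
have ndeta := cumulative_is_nondecreasing eta.
have es0 : 0 <= eta s by rewrite -(eta0 (-1)) ?ltrN10//; apply: ndeta; lra.
have [m] := EVT_max st cw; rewrite in_itv/= => mst wm; have /andP[sm mt] := mst.
have m0 := le_trans s0 sm.
have /andP[_ pm] := phiI m m0.
have emt : eta m <= eta t by exact: ndeta.
have [tm|mt'] := leP (eta t) (w m - beta).
  have em : eta m = eta t by apply/eqP; rewrite eq_le emt; move: pm; rewrite phiE//; lra.
  exists m; split => //; apply/eqP; rewrite eq_le pm phiE//; lra.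
(* A contact at v forces [eta v = w v - beta <= w m - beta], so none can occur above this level. *)
have [||||v [sv vt v0 Mv pv]] := @reflection_growth _ _ _ (Num.max (eta s) (w m - beta)) s t
    eta0 phiI null.
- by rewrite le_max es0.
- by [].
- by rewrite le_max lexx.
- by rewrite gt_max est.
have svt : s <= v <= t by rewrite (ltW sv).
have := wm v; rewrite in_itv/= => /(_ svt).
by move: Mv pv; rewrite gt_max phiE// => /andP[_]; lra.
Qed.

End Reflection.

(** * Uniform continuity and summation of local estimates *)

Section Uniformity.
Context {R : realType}.
Implicit Types (a b : R) (f : R -> R).

Lemma heine_cantor {a b f e} : {within `[a, b], continuous f} -> 0 < e ->
  exists2 d : R, 0 < d & forall u v, a <= u <= b -> a <= v <= b -> `|u - v| < d ->
    `|f u - f v| < e.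
Proof.
move=> /subspace_continuousP cf e0.
have /compact_near_coveringP := @segment_compact R a b.
move=> /(_ R (0^'+) (fun d u => forall v, a <= u <= b -> a <= v <= b ->
   `|u - v| < d -> `|f u - f v| < e)).
move=> [].
  move=> u uab; have e2 : 0 < e / 2 by rewrite divr_gt0.
  have /cvgrPdist_lt/(_ _ e2) := cf u uab.
  move=> /nbhs_ballP[d /= d0 H].
  have d2 : 0 < d / 2 by rewrite divr_gt0.
  exists (ball u (d / 2), [set t | t < d / 2]) => /=.
    split; first exact: nbhsx_ballx.
    exact: nbhs_right_lt.
  move=> [s t] /= [us td] v sab vab sv.
  have hs : `|f u - f s| < e / 2.
    apply: H; last by rewrite /= in_itv.
    by apply: le_ball us; rewrite ler_pdivrMr// ler_pMr// ler1n.
  have hv : `|f u - f v| < e / 2.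
    apply: H; last by rewrite /= in_itv.
    move: us; rewrite /ball/= => us.
    apply: le_lt_trans (ler_distD s _ _) _; move: (lt_trans sv td) us; lra.
  apply: le_lt_trans (ler_distD (f u) _ _) _; rewrite (distrC (f s)); lra.
move=> d /= d0; have d2 : 0 < d / 2 by rewrite divr_gt0.
have dd : d / 2 < d by rewrite gtr_pMr// invf_lt1// ltr1n.
move=> /(_ (d / 2)); rewrite /= sub0r normrN gtr0_norm// => /(_ dd d2) H.
exists (d / 2); first by rewrite divr_gt0.
by move=> u v uab vab uv; apply: (H u) => //; rewrite in_itv.
Qed.

Lemma le_of_local {V : R -> R} {T : R} : 0 <= T ->
  (forall e, 0 < e -> exists2 d, 0 < d & forall a b, 0 <= a -> a <= b -> b <= T ->
     b - a < d -> V b - V a <= e * (b - a)) ->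
  V T <= V 0.
Proof.
move=> T0 H; apply/ler_addgt0Pr => e e0.
(* The accumulated error e T / (T + 1) is at most e; the 1 covers T = 0. *)
have e1 : 0 < e / (T + 1) by rewrite divr_gt0//; lra.
have [d d0 Hd] := H _ e1.
pose N := (Num.truncn (T / d)).+1.
have N0 : 0 < N%:R :> R by rewrite ltr0n.
have dN : T / N%:R < d.
  by rewrite ltr_pdivrMr// mulrC -ltr_pdivrMr// truncnS_gt.
have st : 0 <= T / N%:R by rewrite divr_ge0// ltW.
pose t k := k%:R * (T / N%:R).
have tN : t N = T by rewrite /t mulrCA divff ?gt_eqF// mulr1.
have tm k l : (k <= l)%N -> t k <= t l.
  by move=> kl; rewrite ler_wpM2r// ler_nat.
have step k : (k <= N)%N -> V (t k) - V 0 <= e / (T + 1) * t k.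
  elim: k => [_|k ih kN]; first by rewrite /t mul0r subrr mulr0.
  have dk : t k.+1 - t k < d by rewrite /t -natr1; apply: le_lt_trans dN; lra.
  have t0 : 0 <= t k by rewrite mulr_ge0.
  have := Hd (t k) (t k.+1) t0 (tm _ _ (leqnSn k)) _ dk.
  rewrite -[X in _ <= X]tN => /(_ (tm _ _ kN)).
  have := ih (ltnW kN); lra.
have := step N (leqnn _); rewrite tN => h.
have : e / (T + 1) * T <= e by rewrite mulrAC ler_pdivrMr ?ler_pM2l//; lra.
lra.
Qed.

End Uniformity.

(** * Integral curves of a positive continuous speed *)

Section Flow.
Context {R : realType}.

Lemma Rintegral_derive {f : R -> R} {a u : R} : continuous f -> a < u ->
  is_derive u 1 (fun t => \int[lebesgue_measure]_(s in `[a, t]) f s) (f u).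
Proof.
move=> cf au; have i1 : lebesgue_measure.-integrable `[a, u + 1] (EFin \o f).
  apply: continuous_compact_integrable; first exact: segment_compact.
  exact: continuous_subspaceT.
have uu : u < u + 1 by rewrite ltrDl.
have [dF F'] := continuous_FTC1_closed uu i1 au (cf u).
by split; [exact: dF|rewrite -derive1E].
Qed.

(* phi is the time reversal of the inverse of the integral of 1 / sigma. *)
Lemma backward_flow {sigma : R -> R} {d a z : R} : a < z -> continuous sigma ->
  0 < d -> (forall u, d <= sigma u) ->
  exists (phi : R -> R) (T : R), [/\ continuous phi, phi 0 = z, 0 < T /\ phi T = a,
    forall t, 0 <= t <= T -> a <= phi t <= z &
    forall t, 0 < t < T -> is_derive t 1 phi (- sigma (phi t))].
Proof.
move=> az cs d0 sd.
have s0 u : 0 < sigma u by exact: lt_le_trans d0 (sd u).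
have cV : continuous (fun u => (sigma u)^-1).
  by move=> u; apply: cvgV; [rewrite gt_eqF|exact: cs].
(* Starting at a - 1 makes f differentiable at a as well. *)
pose f t := \int[lebesgue_measure]_(s in `[a - 1, t]) (sigma s)^-1.
have df u : a - 1 < u -> is_derive u 1 f (sigma u)^-1 by exact: Rintegral_derive.
have cf u : a - 1 < u -> {for u, continuous f}.
  by move=> /df[/derivable1_diffP/differentiable_continuous].
have cfaz : {within `[a, z], continuous f}.
  apply: derivable_within_continuous => u; rewrite in_itv/= => /andP[au _].
  by have [] := df u (lt_le_trans _ au); rewrite ?gtrBl.
have incf u v : a <= u -> u < v -> v <= z -> f u < f v.
  move=> au uv vz; have [||w _ E] := @MVT R f (fun u => (sigma u)^-1) u v uv.
  - move=> w; rewrite in_itv/= => /andP[uw _]; apply: df.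
    by apply: lt_trans uw; rewrite ltrBlDr; apply: le_lt_trans au _; rewrite ltrDl.
  - apply: continuous_subspaceW cfaz; by apply: subset_itv; rewrite bnd_simp.
  - by rewrite -subr_gt0 E mulr_gt0 ?invr_gt0// subr_gt0.
have injf : {in `[a, z]%classic &, injective f}.
  move=> u v; rewrite !inE/= !in_itv/= => /andP[au uz] /andP[av vz] fuv.
  have [uv|vu|//] := ltgtP u v.
    by have := incf _ _ au uv vz; rewrite fuv ltxx.
  by have := incf _ _ av vu uz; rewrite fuv ltxx.
pose g := 'pinv_(fun=> 0) `[a, z] f.
have gK u : a <= u <= z -> g (f u) = u.
  by move=> uaz; apply: (pinvKV _ injf); rewrite inE/= in_itv.
have faz : f a < f z by apply: incf => //; rewrite lexx.
have fle := ltW faz.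
have surj s : f a <= s <= f z -> exists2 u, a <= u <= z & f u = s.
  move=> /andP[as_ sz]; have [|u] := @IVT R f a z s (ltW az) cfaz.
    by rewrite min_l// max_r// as_ sz.
  by rewrite in_itv/= => uaz fu; exists u.
have cg : {within `[f a, f z], continuous g}.
  have : {in `[a, z], cancel f g} by move=> u; rewrite in_itv/=; exact: gK.
  by move=> /(segment_can_continuous (ltW az) cfaz); rewrite min_l// max_r.
pose phi t := g (clip (f a) (f z) (f z - t)).
have clipE t : 0 <= t <= f z - f a -> clip (f a) (f z) (f z - t) = f z - t.
  by move=> /andP[t0 tT]; apply: clip_id; apply/andP; split; lra.
have phiE t : 0 <= t <= f z - f a -> a <= phi t <= z /\ f (phi t) = f z - t.
  move=> tT; have [|u uaz fu] := surj (f z - t).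
    by case/andP: tT => *; apply/andP; split; lra.
  by rewrite /phi clipE// -fu gK.
exists phi, (f z - f a); split.
- move=> t; apply: (@continuous_comp _ _ _ (fun t => f z - t) (g \o clip (f a) (f z))).
    by apply: cvgB; [exact: cvg_cst|exact: cvg_id].
  exact: continuous_comp_clip (ltW faz) cg _.
- by rewrite /phi clipE ?subr0 ?gK ?lexx ?subr_ge0 ?fle ?(ltW az).
- split; first by rewrite subr_gt0.
  by rewrite /phi clipE ?subKr ?gK ?lexx ?subr_ge0 ?fle ?(ltW az).
- by move=> t /phiE[].
- move=> t /andP[t0 tT].
  have tT' : 0 <= t <= f z - f a by rewrite !ltW.
  have [/andP[ap pz] fp] := phiE t tT'.
  have {}ap : a < phi t.
    rewrite lt_neqAle ap andbT; apply: contraTneq tT => pE.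
    by rewrite -leNgt pE fp; lra.
  have {}pz : phi t < z.
    rewrite lt_neqAle pz andbT; apply: contraTneq t0 => pE.
    by move: fp; rewrite pE -leNgt; lra.
  have dg : is_derive (f (phi t)) 1 g (sigma (phi t)).
    rewrite -[X in is_derive _ _ _ X]invrK; apply: is_derive_inverse.
    + near=> u; apply: gK; apply/andP; split; apply/ltW; near: u.
        exact: lt_nbhsr.
      exact: lt_nbhsl.
    + near=> u; apply: cf; apply: lt_trans (_ : a < u); first by rewrite gtrBl.
      by near: u; exact: lt_nbhsr.
    + by apply: df; apply: lt_trans ap; rewrite gtrBl.
    + by rewrite invr_eq0 gt_eqF.
  rewrite fp in dg.
  have dm : is_derive t 1 (fun s => f z - s) (- 1).
    by apply: is_derive_eq; rewrite add0r mul1r.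
  have := @is_derive1_comp R g (fun s => f z - s) t _ _ dg dm; rewrite mulrN1.
  apply: near_eq_is_derive; near=> s; rewrite /phi /= clipE//.
  apply/andP; split; apply/ltW; near: s; [exact: lt_nbhsr|exact: lt_nbhsl].
Unshelve. all: by end_near. Qed.

End Flow.

(** * The Hamilton-Jacobi equation and convexity of g below the barrier *)

Section ValueFunction.
Context {R : realType} {D r c y : R} {h : R -> R}.
Context (D_gt0 : 0 < D) (r_gt0 : 0 < r) (c_gt0 : 0 < c).
Context (h_cont : {within `[0, D], continuous h})
  (h_incr : forall u v : R, 0 <= u -> u < v -> v <= D -> h u < h v)
  (h_ge0 : forall u : R, 0 <= u <= D -> 0 <= h u) (h0 : h 0 = 0)
  (y_le : r / (4 * c) <= - y).

Let q := r ^+ 2 / (4 * c) + r * y.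
Let beta0 := barrier_level D r c y h.

Definition speed u := Num.sqrt (y ^+ 2 - h u / c).
Definition slope u := 2 * c * (- y - speed u).
Definition g_low z := \int[lebesgue_measure]_(u in `[0, z]) slope u.

Lemma h_mono u v : 0 <= u -> u <= v -> v <= D -> h u <= h v.
Proof.
move=> u0; rewrite le_eqVlt => /orP[/eqP -> //|uv] vD.
by apply/ltW; exact: h_incr.
Qed.

(** The drift condition gives q <= 0. If - q <= h D, the intermediate value theorem makes ['pinv] a
    true preimage of - q; otherwise beta0 = D and h D < - q. *)
Lemma barrier_level_spec : [/\ 0 <= beta0, beta0 <= D & h beta0 <= - q].
Proof.
have q0 : q <= 0.
  rewrite /q (_ : _ + _ = r * (r / (4 * c) + y)); last by field; rewrite gt_eqF.
  by rewrite pmulr_rle0// -lerBrDr sub0r.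
rewrite /beta0 /barrier_level -/q q0 andbT; case: ifPn => [hq|]; last first.
  by rewrite -ltNge => hq; split; [exact: ltW|exact: lexx|by rewrite lerNr ltW].
have im : (h @` `[0, D]) (- q).
  have qI : Num.min (h 0) (h D) <= - q <= Num.max (h 0) (h D).
    rewrite h0 ge_min le_max oppr_ge0 q0 /=; apply/orP; right.
    by rewrite lerNl.
  have [z zD hz] := IVT (ltW D_gt0) h_cont qI.
  by exists z.
set z := 'pinv_ _ _ _ _.
have zE : h z = - q by apply: pinvK; rewrite inE.
have : `[0, D]%classic z.
  have surj : set_surj `[0, D]%classic (h @` `[0, D]) h by [].
  by have := surjpinv_image_sub (dflt := fun=> 0) surj; apply; exists (- q).
by rewrite /= in_itv/= => /andP[z0 zD]; split; rewrite ?zE.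
Qed.

(** Since - q / c = y^2 - (y + r / (2 c))^2, this is h <= - q rewritten. It makes the square root
    genuine and yields the bound r on the slope. *)
Lemma speed_disc u : 0 <= u <= beta0 ->
  (y + r / (2 * c)) ^+ 2 <= y ^+ 2 - h u / c.
Proof.
have [b0 bD hb] := barrier_level_spec.
move=> /andP[u0 ub]; have hu := le_trans (h_mono _ _ u0 ub bD) hb.
have : h u / c <= - q / c by rewrite ler_pM2r// invr_gt0.
have -> : - q / c = y ^+ 2 - (y + r / (2 * c)) ^+ 2.
  by rewrite /q; field; rewrite gt_eqF.
lra.
Qed.

Lemma speed_sqr u : 0 <= u <= beta0 -> speed u ^+ 2 = y ^+ 2 - h u / c.
Proof.
by move=> ub; rewrite sqr_sqrtr// (le_trans _ (speed_disc u ub))// sqr_ge0.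
Qed.

Lemma speed_ge0 u : 0 <= speed u. Proof. exact: sqrtr_ge0. Qed.

Lemma y_lt0 : y < 0.
Proof. by rewrite -oppr_gt0 (lt_le_trans _ y_le)// divr_gt0// mulr_gt0. Qed.

Lemma slope_ge0 u : 0 <= u <= beta0 -> 0 <= slope u.
Proof.
move=> ub; have [b0 bD hb] := barrier_level_spec.
apply: mulr_ge0; first by rewrite mulr_ge0// ltW.
rewrite subr_ge0.
rewrite -(@ler_pXn2r _ 2)// ?nnegrE ?speed_ge0 ?oppr_ge0 ?(ltW y_lt0)//.
rewrite speed_sqr// sqrrN gerBl divr_ge0// ?(ltW c_gt0)// h_ge0//.
by move: ub => /andP[-> /le_trans ->].
Qed.

Lemma slope_le u : 0 <= u <= beta0 -> slope u <= r.
Proof.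
move=> ub; have : - (y + r / (2 * c)) <= speed u.
  apply: le_trans (ler_norm _) _; rewrite normrN -sqrtr_sqr.
  by rewrite ler_sqrt; [exact: speed_disc|exact: le_trans (sqr_ge0 _) (speed_disc u ub)].
move=> su; rewrite /slope -ler_pdivlMl ?mulr_gt0//.
rewrite (_ : _^-1 * r = r / (2 * c)); last by rewrite mulrC.
lra.
Qed.

Lemma slope_hjb u : 0 <= u <= beta0 -> slope u ^+ 2 / (4 * c) + y * slope u + h u = 0.
Proof.
move=> /speed_sqr s2; have -> : h u = c * (y ^+ 2 - speed u ^+ 2).
  by rewrite s2; field; rewrite gt_eqF.
by rewrite /slope; field; rewrite gt_eqF.
Qed.

Lemma slope_mono u v : 0 <= u -> u <= v -> v <= beta0 -> slope u <= slope v.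
Proof.
have [b0 bD hb] := barrier_level_spec.
move=> u0 uv vb; rewrite /slope ler_pM2l ?mulr_gt0// lerD2l lerN2.
apply: ler_wsqrtr; rewrite lerD2l lerN2 ler_pM2r ?invr_gt0// h_mono//.
exact: le_trans bD.
Qed.

Lemma speed_continuous : {within `[0, D], continuous speed}.
Proof.
move=> u; apply: continuous_comp; last exact: sqrt_continuous.
apply: cvgB; first exact: cvg_cst.
by apply: cvgMl; exact: h_cont.
Qed.

Lemma slope_continuous : {within `[0, D], continuous slope}.
Proof.
move=> u; apply: cvgMr; apply: cvgB; [exact: cvg_cst|exact: speed_continuous].
Qed.

Lemma slope_integrable : lebesgue_measure.-integrable `[0, D] (EFin \o slope).
Proof.
apply: continuous_compact_integrable; first exact: segment_compact.
exact: slope_continuous.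
Qed.

Lemma g_low_sub u v : 0 <= u -> u <= v -> v <= D ->
  g_low v - g_low u = \int[lebesgue_measure]_(t in `]u, v]) slope t.
Proof.
move=> u0 uv vD.
have iv : lebesgue_measure.-integrable `[0, v] (EFin \o slope).
  have m1 : measurable (`[0, D]%classic : set (measurableTypeR R)) by exact: measurable_itv.
  have m2 : measurable (`[0, v]%classic : set (measurableTypeR R)) by exact: measurable_itv.
  apply: integrableS m1 m2 _ slope_integrable; apply: subset_itvl.
  by rewrite bnd_simp.
by apply: (Rintegral_itvB iv); rewrite bnd_simp.
Qed.

Lemma Rintegral_oc_cst (k u v : R) : u <= v ->
  \int[lebesgue_measure]_(_ in `]u, v]) k = k * (v - u).
Proof.
move=> uv; rewrite Rintegral_cst; last exact: measurable_itv.
by have muE := lebesgue_stieltjes_measure_oc idfun _ _ uv; rewrite [X in fine X]muE.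
Qed.

Lemma integrable_oc_cst (k u v : R) :
  lebesgue_measure.-integrable `]u, v] (EFin \o (fun=> k)).
Proof.
have m1 : measurable (`[u, v]%classic : set (measurableTypeR R)) by exact: measurable_itv.
have m2 : measurable (`]u, v]%classic : set (measurableTypeR R)) by exact: measurable_itv.
apply: (integrableS m1 m2); first exact: subset_itv_oc_cc.
apply: continuous_compact_integrable; first exact: segment_compact.
by apply: continuous_subspaceT; exact: cst_continuous.
Qed.

Lemma slope_integrable_oc u v : 0 <= u -> v <= D ->
  lebesgue_measure.-integrable `]u, v] (EFin \o slope).
Proof.
move=> u0 vD.
have m1 : measurable (`[0, D]%classic : set (measurableTypeR R)) by exact: measurable_itv.
have m2 : measurable (`]u, v]%classic : set (measurableTypeR R)) by exact: measurable_itv.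
apply: integrableS m1 m2 _ slope_integrable => t; rewrite /= !in_itv/=.
by move=> /andP[ut tv]; rewrite (le_trans u0 (ltW ut)) (le_trans tv vD).
Qed.

(** Convexity: the graph lies above its supporting line at v, because [slope] is nondecreasing. It
    replaces the chain rule along a path. *)
Lemma g_low_le u v : 0 <= u <= beta0 -> 0 <= v <= beta0 ->
  g_low v - g_low u <= slope v * (v - u).
Proof.
have [b0 bD hb] := barrier_level_spec.
move=> /andP[u0 ub] /andP[v0 vb].
have m (a b : R) : measurable (`]a, b]%classic : set (measurableTypeR R)).
  exact: measurable_itv.
have [uv|/ltW vu] := leP u v.
  rewrite g_low_sub ?(le_trans vb)// -Rintegral_oc_cst//.
  apply: le_Rintegral => //.
  - by apply: slope_integrable_oc => //; exact: le_trans bD.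
  - exact: integrable_oc_cst.
  - move=> t; rewrite /= in_itv/= => /andP[ut tv]; apply: slope_mono => //.
    exact: le_trans u0 (ltW ut).
rewrite -lerN2 opprB -mulrN opprB.
rewrite g_low_sub ?(le_trans ub)// -Rintegral_oc_cst//.
apply: le_Rintegral => //.
- exact: integrable_oc_cst.
- by apply: slope_integrable_oc => //; exact: le_trans bD.
- move=> t; rewrite /= in_itv/= => /andP[ut tv]; apply: slope_mono => //.
    exact: ltW.
  exact: le_trans ub.
Qed.

Lemma g_low0 : g_low 0 = 0.
Proof. by rewrite /g_low set_itv1 Rintegral_set1. Qed.

Lemma g_low_ge0 v : 0 <= v <= beta0 -> 0 <= g_low v.
Proof.
move=> /andP[v0 vb]; apply: Rintegral_ge0 => t; rewrite /= in_itv/= => /andP[t0 tv].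
by apply: slope_ge0; rewrite t0 (le_trans tv vb).
Qed.


(** * Verification along a reflected path *)

Section UpperBound.
Context {T x : R} {w phi e : R -> R} {eta : cumulative R R}.
Context (T_ge0 : 0 <= T) (xD : 0 <= x <= D).
Context (eta0 : forall u, u < 0 -> eta u = 0)
  (phiI : forall u, 0 <= u -> 0 <= phi u <= beta0)
  (null : (\int[lebesgue_stieltjes_measure eta]_(u in `[0%R, +oo[)
         (\1_(`[0, beta0[ : set R) (phi u))%:E = 0)%E)
  (w0 : w 0 = x) (w_cont : {within `[0, T], continuous w})
  (phiE : forall u, 0 <= u <= T -> phi u = w u - eta u)
  (e0 : e 0 = 0)
  (eE : forall p u v, 0 <= u -> u <= v -> v <= T ->
     p * ((w v - y * v) - (w u - y * u)) - p ^+ 2 / (4 * c) * (v - u) <= e v - e u).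

(** A bounded measurable function on the line that agrees with the running cost [h (phi t)] on
    [[0, T]]. *)
Let k t := h (clip 0 D (w (clip 0 T t) - eta t)).
Let V t := \int[lebesgue_measure]_(s in `[0, t]) k s + r * eta t - e t + g_low (phi t).

Let mitv (a b : R) : measurable (`]a, b]%classic : set (measurableTypeR R)).
Proof. exact: measurable_itv. Qed.

Let mitv' (a b : R) : measurable (`[a, b]%classic : set (measurableTypeR R)).
Proof. exact: measurable_itv. Qed.

Let ndeta : {homo eta : u v / u <= v} := cumulative_is_nondecreasing eta.

Let kE t : 0 <= t <= T -> k t = h (phi t).
Proof.
have [b0 bD hb] := barrier_level_spec.
move=> tT; have /andP[t0 _] := tT; have /andP[p0 pb] := phiI t t0.
by rewrite /k (clip_id 0 T)// -phiE// clip_id// p0 (le_trans pb bD).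
Qed.

Let mk : measurable_fun [set: measurableTypeR R] k.
Proof.
have hc := continuous_comp_clip (ltW D_gt0) h_cont.
have wc := continuous_comp_clip T_ge0 w_cont.
apply: (@measurableT_comp _ _ _ _ _ _ (h \o clip 0 D)).
  exact: continuous_measurable_fun.
apply: measurable_funB; first exact: (continuous_measurable_fun wc).
exact: nondecreasing_measurable.
Qed.

Let k_bound t : 0 <= k t <= h D.
Proof.
have /andP[t0 tD] := clip_itv 0 D (w (clip 0 T t) - eta t) (ltW D_gt0).
by rewrite h_ge0 ?t0// h_mono.
Qed.

Let ik (a b : R) : lebesgue_measure.-integrable `[a, b] (EFin \o k).
Proof.
have ic : lebesgue_measure.-integrable `[a, b] (EFin \o (fun _ : R => h D)).
  apply: continuous_compact_integrable; first exact: segment_compact.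
  by apply: continuous_subspaceT; exact: cst_continuous.
apply: (le_integrable (mitv' a b) _ _ ic); first by apply/measurable_funTS/measurable_EFinP.
move=> t _ /=; have /andP[k0 kD] := k_bound t.
by rewrite lee_fin !ger0_norm// (le_trans k0).
Qed.

Let k_sub a b : 0 <= a -> a <= b ->
  \int[lebesgue_measure]_(s in `[0, b]) k s - \int[lebesgue_measure]_(s in `[0, a]) k s
  = \int[lebesgue_measure]_(s in `]a, b]) k s.
Proof. by move=> a0 ab; apply: (Rintegral_itvB (ik 0 b)); rewrite bnd_simp. Qed.

Let k_int_le a b C : 0 <= a -> a <= b -> (forall t, a <= t <= b -> k t <= C) ->
  \int[lebesgue_measure]_(s in `[0, b]) k s - \int[lebesgue_measure]_(s in `[0, a]) k s
  <= C * (b - a).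
Proof.
move=> a0 ab kC; rewrite k_sub// -Rintegral_oc_cst//.
apply: le_Rintegral => //; last 1 first.
- by move=> t; rewrite /= in_itv/= => /andP[a_t tb]; apply: kC; rewrite (ltW a_t).
- apply: integrableS (mitv' a b) (mitv a b) _ (ik a b).
  exact: subset_itv_oc_cc.
- exact: integrable_oc_cst.
Qed.

(* Between contact times the verification inequality for the slope at the
   right end point is exact up to the oscillation of the running cost. *)
Let V_free a b E : 0 <= a -> a <= b -> b <= T -> eta a = eta b ->
  (forall t, a <= t <= b -> h (phi t) <= h (phi b) + E) ->
  V b - V a <= E * (b - a).
Proof.
move=> a0 ab bT eab osc.
have b0 := le_trans a0 ab; have aT := le_trans ab bT.
have pa := phiI a a0; have pb := phiI b b0.
have h1 : \int[lebesgue_measure]_(s in `[0, b]) k s -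
    \int[lebesgue_measure]_(s in `[0, a]) k s <= (h (phi b) + E) * (b - a).
  apply: k_int_le => // t /andP[a_t tb]; rewrite kE ?osc ?a_t//.
  by rewrite (le_trans a0 a_t) (le_trans tb bT).
have h2 := eE (slope (phi b)) a b a0 ab bT.
have h3 := g_low_le (phi a) (phi b) pa pb.
have h4 := slope_hjb (phi b) pb.
have dphi : phi b - phi a = w b - w a.
  by rewrite !phiE ?a0 ?b0 ?aT ?bT// eab; ring.
rewrite dphi in h3; rewrite /V eab.
set p := slope (phi b) in h2 h3 h4; set H := h (phi b) in h1 h4.
have h5 : (p ^+ 2 / (4 * c) + y * p + H) * (b - a) = 0 by rewrite h4 mul0r.
set I1 := \int[_]_(_ in _) _ in h1 *; set I2 := \int[_]_(_ in _) _ in h1 *.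
set Q := p ^+ 2 / (4 * c) in h2 h5.
(* The terms p (w b - w a) from [h2] and [h3] cancel, and [h5] removes all but E (b - a). *)
nra.
Qed.

(* Up to a contact time the slope r gives a nonpositive increment, because
   h is at most - q on [0, beta0]. *)
Let V_contact a b : 0 <= a -> a <= b -> b <= T -> phi b = beta0 -> V b - V a <= 0.
Proof.
have [b_ge0 bD hb] := barrier_level_spec.
move=> a0 ab bT pbE.
have b0 := le_trans a0 ab; have aT := le_trans ab bT.
have pa := phiI a a0; have pb := phiI b b0.
have h1 : \int[lebesgue_measure]_(s in `[0, b]) k s -
    \int[lebesgue_measure]_(s in `[0, a]) k s <= - q * (b - a).
  apply: k_int_le => // t /andP[a_t tb].
  have t0 := le_trans a0 a_t.
  rewrite kE ?t0 ?(le_trans tb bT)//; apply: le_trans hb.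
  by have /andP[p0 pB] := phiI t t0; exact: h_mono.
have h2 := eE r a b a0 ab bT.
have h3 := g_low_le (phi a) (phi b) pa pb.
(* Contact is used here: phi b = beta0 makes the increment of phi nonnegative, so the slope may be
   raised to r, and r times the reflection cancels. *)
have h3' : slope (phi b) * (phi b - phi a) <= r * (phi b - phi a).
  by rewrite ler_wpM2r ?slope_le// pbE subr_ge0; case/andP: pa.
have dphi : phi b - phi a = w b - w a - (eta b - eta a).
  by rewrite !phiE ?a0 ?b0 ?aT ?bT//; ring.
rewrite dphi in h3'; rewrite /V.
have h5 : - q * (b - a) = - (r ^+ 2 / (4 * c)) * (b - a) - r * y * (b - a).
  by rewrite /q; ring.
nra.
Qed.

(** If eta grows on [[a, b]], there is a contact time u with eta u = eta b: [V_contact] covers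
    [[a, u]] and [V_free] covers [[u, b]]. While eta is constant, phi oscillates no more than w, so
    d comes from the moduli of h and w. *)
Let V_local E : 0 < E -> exists2 d, 0 < d & forall a b, 0 <= a -> a <= b -> b <= T ->
     b - a < d -> V b - V a <= E * (b - a).
Proof.
have [b_ge0 bD hb] := barrier_level_spec.
move=> E0; have [d1 d10 H1] := heine_cantor h_cont E0.
have [d d0 H2] := heine_cantor w_cont d10; exists d => // a b a0 ab bT dab.
have phiD t : 0 <= t -> 0 <= phi t <= D.
  by move=> /phiI /andP[-> pb]; exact: le_trans bD.
have free u : a <= u -> u <= b -> eta u = eta b -> V b - V u <= E * (b - u).
  move=> au ub eub; have u0 := le_trans a0 au.
  apply: V_free => // t /andP[ut tb].
  have t0 := le_trans u0 ut; have tT := le_trans tb bT.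
  have et : eta t = eta b.
    by apply/eqP; rewrite eq_le ndeta//= -eub ndeta.
  have ptb : `|phi t - phi b| < d1.
    rewrite !phiE ?t0 ?(le_trans a0 ab)// et (_ : _ - _ = w t - w b); last by ring.
    apply: H2; rewrite ?t0 ?(le_trans a0 ab)//.
    by rewrite distrC ger0_norm ?subr_ge0//; lra.
  have := H1 _ _ (phiD t t0) (phiD b (le_trans a0 ab)) ptb.
  by move=> /(le_lt_trans (ler_norm _)); lra.
have : eta a <= eta b by exact: ndeta.
rewrite le_eqVlt => /orP[/eqP eab|eab]; first exact: free.
have wab : {within `[a, b], continuous w}.
  by apply: continuous_subspaceW w_cont; apply: subset_itv; rewrite bnd_simp.
have phiEab u : a <= u <= b -> phi u = w u - eta u.
  by move=> /andP[au ub]; apply: phiE; rewrite (le_trans a0 au) (le_trans ub bT).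
have [u [au ub pu eub]] := reflection_contact eta0 phiI null a0 ab wab phiEab eab.
have := free u au ub eub; have := V_contact a u a0 au (le_trans ub bT) pu.
have : 0 <= E * (u - a) by rewrite mulr_ge0 ?subr_ge0// ltW.
lra.
Qed.

(** Without a jump at 0, x = phi 0 <= beta0. A jump must land on beta0, which gives the linear
    branch of g; applying [reflection_growth] from -1 to 0 makes the jump visible. *)
Lemma V0_value : r * eta 0 + g_low (phi 0) = value_function D r c y h x.
Proof.
have [b_ge0 bD hb] := barrier_level_spec.
have p0 : phi 0 = x - eta 0 by rewrite phiE ?lexx// w0.
have e00 : 0 <= eta 0 by have := ndeta (-1) 0 (lerN10 _); rewrite (eta0 (-1)) ?ltrN10.
have /andP[p00 p0b] := phiI 0 (lexx _).
rewrite /value_function -/beta0.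
move: e00; rewrite le_eqVlt => /orP[/eqP e00|e0_gt0].
  have p0x : phi 0 = x by rewrite p0 -e00 subr0.
  by rewrite -{1}p0x p0b -e00 mulr0 add0r p0x.
have [||||v [sv v0 v0' ev pv]] := @reflection_growth R beta0 phi eta 0 (-1) 0 eta0 phiI null.
- by [].
- by rewrite lerN10.
- by rewrite eta0 ?ltrN10.
- exact: e0_gt0.
have vE : v = 0 by apply/eqP; rewrite eq_le v0 v0'.
rewrite vE in pv; have xE : eta 0 = x - beta0 by rewrite -pv p0; ring.
have -> : (x <= beta0) = false by apply/negbTE; rewrite -ltNge -subr_gt0 -xE.
by rewrite pv xE addrC.
Qed.

Lemma cost_upper_bound :
  \int[lebesgue_measure]_(s in `[0, T]) h (phi s) + r * eta T - e T
    <= value_function D r c y h x.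
Proof.
have VT := le_of_local T_ge0 V_local.
have gT : 0 <= g_low (phi T) by apply: g_low_ge0; exact: phiI.
have kT : \int[lebesgue_measure]_(s in `[0, T]) h (phi s) =
    \int[lebesgue_measure]_(s in `[0, T]) k s.
  by apply: eq_Rintegral => t; rewrite inE /= in_itv/= => /kE.
have V0 : V 0 = value_function D r c y h x.
  by rewrite /V set_itv1 Rintegral_set1 e0 subr0 add0r V0_value.
rewrite -V0 kT; move: VT; rewrite {1}/V; lra.
Qed.

Lemma cost_upper_bound_ereal :
  (\int[lebesgue_measure]_(s in `[0%R, T]) (h (phi s))%:E + (r * eta T)%:E
    - (e T)%:E <= (value_function D r c y h x)%:E)%E.
Proof.
have -> : (\int[lebesgue_measure]_(s in `[0%R, T]) (h (phi s))%:E =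
    (\int[lebesgue_measure]_(s in `[0, T]) h (phi s))%R%:E)%E.
  rewrite /Rintegral fineK//.
  have := integrable_fin_num (mitv' 0 T) (ik 0 T).
  congr (_ \is a fin_num); apply: eq_integral => t; rewrite inE /= in_itv/=.
  by move=> /kE ->.
by have := cost_upper_bound; rewrite -lee_fin EFinB EFinD.
Qed.

End UpperBound.


(** * A nearly optimal path *)

Section NearOptimal.
Context {d z J : R} (d_gt0 : 0 < d) (zb : 0 <= z <= beta0) (J_ge0 : 0 <= J).

(* With the velocity v = - (speed + d) the running profit h - c (v - y)^2
   equals - (g_low o phi)' - c d^2, and d T <= z; the shift by d keeps the
   hitting time finite when the speed vanishes at beta0. *)
Lemma near_optimal_path : exists (phi : R -> R) (T T' : R),
  let v t := - (speed (clip 0 D (phi t)) + d) in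
  [/\ continuous phi, phi 0 = z, [/\ 0 <= T, phi T = 0, 0 <= T' & phi T' = - J - 1],
    (forall t, 0 < t -> t <= T -> phi t < z) /\ (forall t, 0 <= t -> t < T -> 0 < phi t) &
    [/\ continuous v,
      forall t, 0 < t < T -> is_derive t 1 phi (v t),
      forall s t, 0 <= s -> s <= t -> t <= T -> `|phi t - phi s| <= (d - y) * (t - s) &
      g_low z - c * d * z <=
        \int[lebesgue_measure]_(t in `[0, T]) h (phi t) -
        \int[lebesgue_measure]_(t in `[0, T]) (c * (v t - y) ^+ 2)]].
Proof.
have [b_ge0 bD hb] := barrier_level_spec.
have /andP[z0 zb'] := zb; have zD := le_trans zb' bD.
pose sigma u := speed (clip 0 D u) + d.
have cs : continuous sigma.
  have := continuous_comp_clip (ltW D_gt0) speed_continuous => cc u.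
  by apply: cvgD; [exact: cc|exact: cvg_cst].
have sd u : d <= sigma u by rewrite lerDr speed_ge0.
(* After an initial jump of size J the unreflected path will be J + phi; at the level - J - 1 of phi
   it equals -1. *)
have J0 := J_ge0; have az : - J - 1 < z by lra.
have [phi [T' [cphi phi0 [T'0 phiT'] phiI dphi]]] := backward_flow az cs d_gt0 sd.
have decr s t : 0 <= s -> s < t -> t <= T' -> phi t < phi s.
  move=> s0 st tT; have [||w wst E] := @MVT R phi (fun t => - sigma (phi t)) s t st.
  - move=> w; rewrite in_itv/= => /andP[sw wt]; apply: dphi.
    by rewrite (le_lt_trans s0 sw) (lt_le_trans wt tT).
  - exact: continuous_subspaceT.
  - rewrite -subr_lt0 E mulNr oppr_lt0 mulr_gt0 ?subr_gt0//.
    exact: lt_le_trans d_gt0 (sd _).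
have [||T] := @IVT R phi 0 T' 0 (ltW T'0).
- exact: continuous_subspaceT.
- by rewrite phi0 phiT' ge_min le_max z0; apply/andP; split; apply/orP; [right|left]; lra.
rewrite in_itv/= => /andP[T0 TT'] phiT.
have phi_lt t : 0 < t -> t <= T -> phi t < z.
  by move=> t0 tT; rewrite -phi0; apply: decr => //; exact: le_trans TT'.
have phi_gt t : 0 <= t -> t < T -> 0 < phi t.
  by move=> t0 tT; rewrite -phiT; apply: decr.
have phizD t : 0 <= t -> t <= T -> 0 <= phi t <= beta0.
  move=> t0 tT; apply/andP; split.
    by move: tT; rewrite le_eqVlt => /orP[/eqP ->|/(phi_gt t t0)/ltW//]; rewrite phiT.
  apply: le_trans zb'; move: t0; rewrite le_eqVlt => /orP[/eqP <-|/phi_lt/(_ tT)/ltW//].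
  by rewrite phi0.
have clipphi t : 0 <= t -> t <= T -> clip 0 D (phi t) = phi t.
  by move=> t0 tT; have /andP[p0 pb] := phizD t t0 tT; rewrite clip_id// p0 (le_trans pb bD).
have cv : continuous (fun t => - sigma (phi t)).
  by move=> t; apply: cvgN; apply: (@continuous_comp _ _ _ phi sigma); [exact: cphi|exact: cs].
exists phi, T, T'; split => //; first by split => //; exact: ltW.
split => //.
- by move=> t /andP[t0 tT]; apply: dphi; rewrite t0 (lt_le_trans tT TT').
- move=> s t s0; rewrite le_eqVlt => /orP[/eqP ->|st] tT.
    by rewrite !subrr normr0 mulr0.
  have [||w wst E] := @MVT R phi (fun t => - sigma (phi t)) s t st.
  + move=> w; rewrite in_itv/= => /andP[sw wt]; apply: dphi.
    by rewrite (le_lt_trans s0 sw) (lt_le_trans wt)// (le_trans tT TT').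
  + exact: continuous_subspaceT.
  + rewrite E normrM normrN (gtr0_norm (lt_le_trans d_gt0 (sd _))).
    rewrite ger0_norm ?subr_ge0 ?(ltW st)// ler_wpM2r ?subr_ge0 ?(ltW st)//.
    rewrite /sigma addrC lerD2l.
    rewrite -[X in _ <= X]ger0_norm ?oppr_ge0 ?(ltW y_lt0)// normrN -sqrtr_sqr.
    apply: ler_wsqrtr; rewrite gerBl divr_ge0 ?(ltW c_gt0)// h_ge0//.
    exact: clip_itv (ltW D_gt0).
pose hk t := h (clip 0 D (phi t)).
have chk : continuous hk.
  move=> t; apply: (@continuous_comp _ _ _ phi (h \o clip 0 D)); first exact: cphi.
  exact: continuous_comp_clip (ltW D_gt0) h_cont _.
pose en t := c * (- sigma (phi t) - y) ^+ 2.
have cen : continuous en.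
  move=> t; apply: cvgMr.
  apply: (@continuous_comp _ _ _ (fun t => - sigma (phi t) - y) (fun a => a ^+ 2)).
    by apply: cvgB; [exact: cv|exact: cvg_cst].
  exact: exprn_continuous.
have int0T (f : R -> R) : continuous f -> lebesgue_measure.-integrable `[0, T] (EFin \o f).
  move=> cf; apply: continuous_compact_integrable; first exact: segment_compact.
  exact: continuous_subspaceT.
have m0T : measurable (`[0, T]%classic : set (measurableTypeR R)) by exact: measurable_itv.
rewrite (_ : \int[lebesgue_measure]_(t in `[0, T]) h (phi t) =
    \int[lebesgue_measure]_(t in `[0, T]) hk t); last first.
  apply: eq_Rintegral => t; rewrite inE/= in_itv/= => /andP[t0 tT].
  by rewrite /hk clipphi.
rewrite -[X in _ <= _ - X]/(\int[lebesgue_measure]_(t in `[0, T]) en t).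
rewrite -(RintegralB m0T (int0T _ chk) (int0T _ cen)).
have slc := continuous_comp_clip (ltW D_gt0) slope_continuous.
pose f t := slope (clip 0 D (phi t)) * sigma (phi t).
have cf : continuous f.
  move=> t; apply: cvgM.
    by apply: (@continuous_comp _ _ _ phi (slope \o clip 0 D)); [exact: cphi|exact: slc].
  by apply: (@continuous_comp _ _ _ phi sigma); [exact: cphi|exact: cs].
have -> : \int[lebesgue_measure]_(t in `[0, T]) (hk t - en t) =
    \int[lebesgue_measure]_(t in `[0, T]) (f t - c * d ^+ 2).
  apply: eq_Rintegral => t; rewrite inE/= in_itv/= => /andP[t0 tT].
  rewrite /hk /en /f /sigma clipphi//.
  have s2 := speed_sqr (phi t) (phizD t t0 tT).
  have -> : h (phi t) = c * (y ^+ 2 - speed (phi t) ^+ 2).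
    by rewrite s2; field; rewrite gt_eqF.
  by rewrite /slope; ring.
rewrite (RintegralB m0T (int0T _ cf)); last by apply: int0T; exact: cst_continuous.
have -> : \int[lebesgue_measure]_(_ in `[0, T]) (c * d ^+ 2) = c * d ^+ 2 * T.
  rewrite -Rintegral_itv_obnd_cbnd; last exact: integrable_oc_cst.
  by rewrite Rintegral_oc_cst// subr0.
move: T0; rewrite le_eqVlt => /orP[/eqP T0|T0].
  rewrite -T0 in phiT; have zE : z = 0 by rewrite -phi0.
  by rewrite -T0 set_itv1 Rintegral_set1 zE g_low0 !mulr0.
(* Velocity at least d in absolute value over the distance z; hence the loss c d^2 T is at most c d
   z. *)
have dT : d * T <= z.
  have [||w wst E] := @MVT R phi (fun t => - sigma (phi t)) 0 T T0.
  - move=> w; rewrite in_itv/= => /andP[sw wt]; apply: dphi.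
    by rewrite sw (lt_le_trans wt).
  - exact: continuous_subspaceT.
  - move: E; rewrite phi0 phiT subr0 sub0r mulNr => /oppr_inj ->.
    by rewrite ler_pM2r.
suff -> : \int[lebesgue_measure]_(t in `[0, T]) f t = g_low z.
  rewrite lerD2l lerN2 expr2 -!mulrA !ler_pM2l//.
(* Clipping makes the integrand continuous on the line, so G is differentiable at every u > 0; on
   [[0, D]] it is [g_low]. *)
pose G u := \int[lebesgue_measure]_(s in `[0, u]) (slope \o clip 0 D) s.
have GE u : 0 <= u -> u <= D -> G u = g_low u.
  move=> u0 uD; apply: eq_Rintegral => t; rewrite inE/= in_itv/= => /andP[t0 tu].
  by rewrite clip_id// t0 (le_trans tu).
have cG : {within `[0, D], continuous G}.
  apply: parameterized_integral_continuous; first exact: ltW.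
  apply: continuous_compact_integrable; first exact: segment_compact.
  exact: continuous_subspaceT.
pose F t := - G (clip 0 D (phi t)).
have cF : continuous F.
  move=> t; apply: cvgN.
  apply: (@continuous_comp _ _ _ phi (G \o clip 0 D)); first exact: cphi.
  exact: continuous_comp_clip (ltW D_gt0) cG _.
have dF t : 0 < t < T -> is_derive t 1 F (f t).
  move=> /andP[t0 tT].
  have p0 := phi_gt t (ltW t0) tT.
  have pz := phi_lt t t0 (ltW tT).
  have dG := Rintegral_derive slc p0.
  have tT' : 0 < t < T' by rewrite t0 (lt_le_trans tT).
  have := @is_derive1_comp R G phi t _ _ dG (dphi t tT').
  move=> /(@is_deriveN _ _ _ _ _ _ _); rewrite mulrN opprK.
  apply: near_eq_is_derive; near=> s; rewrite /F /=.
  by rewrite clipphi//; apply/ltW; near: s; [exact: lt_nbhsr|exact: lt_nbhsl].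
have := @continuous_FTC2 R f F 0 T T0.
rewrite /Rintegral => -> //.
- rewrite /F clip_id ?phiT ?lexx ?(ltW D_gt0)// clip_id ?phi0 ?z0//.
  by rewrite !GE// ?(ltW D_gt0)// g_low0 /= oppr0 add0r opprK.
- exact: continuous_subspaceT.
- split.
  + by move=> t; rewrite in_itv/= => /dF[].
  + by apply: cvg_within_filter; exact: cF.
  + by apply: cvg_within_filter; exact: cF.
- by move=> t; rewrite in_itv/= derive1E => /dF[].
Unshelve. all: by end_near. Qed.

End NearOptimal.

End ValueFunction.

(** * Attainment of the hitting time *)

Section HittingTime.
Context {R : realType}.
Implicit Types (x y t : R) (rho : R -> R) (psi : (R -> R) * (R -> R)).

Lemma lipschitz_abs_continuous {a b K : R} {f : R -> R} : 0 <= K ->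
  (forall u v, a <= u -> u <= v -> v <= b -> `|f v - f u| <= K * (v - u)) ->
  abs_continuous a b f.
Proof.
move=> K0 H e e0; exists (e / (K + 1)); first by rewrite divr_gt0//; lra.
move=> n u v uv _ duv; apply: (@le_lt_trans _ _ (K * \sum_(i < n) (v i - u i))).
  by rewrite mulr_sumr; apply: ler_sum => i _; have [h1 h2 h3] := uv i; exact: H.
have s0 : 0 <= \sum_(i < n) (v i - u i).
  by apply: sumr_ge0 => i _; have [_ h2 _] := uv i; rewrite subr_ge0.
move: duv; rewrite ltr_pdivlMr; last by lra.
nra.
Qed.

Lemma hitting_time_ge0 y x psi rho : (0 <= hitting_time y x psi rho)%E.
Proof. by apply: le_ereal_inf_tmp => _ [t [t0 _] <-]; rewrite lee_fin. Qed.

Lemma hitting_time_le {y x psi rho t} : 0 <= t -> trajectory y x psi rho t = 0 ->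
  (hitting_time y x psi rho <= t%:E)%E.
Proof. by move=> t0 tr; apply: ereal_inf_lbound; exists t. Qed.

Lemma hitting_time_fineK {y x psi rho} : (hitting_time y x psi rho < +oo)%E ->
  (fine (hitting_time y x psi rho))%:E = hitting_time y x psi rho.
Proof. by move=> h; rewrite fineK// ge0_fin_numE// hitting_time_ge0. Qed.

(** Right continuity suffices: a nonzero value at the infimum S would persist just after S, while
    zeros occur at S or arbitrarily close to its right. *)
Lemma trajectory_hitting_time {y x psi rho} : cont_paths2 psi -> incr_paths rho ->
  (hitting_time y x psi rho < +oo)%E ->
  trajectory y x psi rho (fine (hitting_time y x psi rho)) = 0.
Proof.
move=> [[c1 _] [c2 _]] [_ _ [rc _]] fin.
set S := fine _; have SE : S%:E = hitting_time y x psi rho := hitting_time_fineK fin.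
have S0 : 0 <= S by rewrite -lee_fin SE hitting_time_ge0.
have cr (f : R -> R) : {within `[0, +oo[, continuous f} -> f t @[t --> S^'+] --> f S.
  move=> /subspace_continuousP/(_ S); rewrite /= in_itv/= S0 => /(_ isT).
  apply: cvg_trans => A; rewrite /= /within/= => -[e e0 he].
  exists e => //= t te St; apply: he => //; rewrite in_itv/= andbT.
  exact: le_trans S0 (ltW St).
have ctr : trajectory y x psi rho t @[t --> S^'+] --> trajectory y x psi rho S.
  apply: cvgB; last exact: rc.
  apply: cvgB; last exact: cr.
  apply: cvgD; last exact: cr.
  apply: cvg_at_right_filter.
  by apply: cvgD; [exact: cvg_cst|apply: cvgMr; exact: cvg_id].
apply: contrapT => /eqP trS.
have n0 : `|trajectory y x psi rho S| > 0 by rewrite normr_gt0.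
have /cvgrPdist_lt/(_ _ n0)[e /= e0 He] := ctr.
have fS : hitting_time y x psi rho \is a fin_num by rewrite -SE.
have [_ [t [t0 trt] <-] te] := lb_ereal_inf_adherent e0 fS.
have : (hitting_time y x psi rho <= t%:E)%E by exact: hitting_time_le.
rewrite -SE lee_fin le_eqVlt => /orP[/eqP St|St].
  by move: trS; rewrite St trt eqxx.
have := He t; rewrite trt subr0 ltxx /= => H.
have : false; last by [].
apply: H => //; rewrite /ball_ /= distrC gtr0_norm ?subr_gt0//.
by move: te; rewrite -/(hitting_time y x psi rho) -SE -EFinD lte_fin; lra.
Qed.

End HittingTime.

(** * The two inequalities for the game value *)

Section Game.
Context {R : realType} {D r c1 c2 y : R} {h : R -> R}.
Context (D_gt0 : 0 < D) (r_gt0 : 0 < r) (c1_gt0 : 0 < c1) (c2_gt0 : 0 < c2).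
Context (h_cont : {within `[0, D], continuous h})
  (h_incr : forall u v : R, 0 <= u -> u < v -> v <= D -> h u < h v)
  (h_ge0 : forall u : R, 0 <= u <= D -> 0 <= h u) (h0 : h 0 = 0).

Let c := (c1^-1 + c2^-1)^-1.
Let beta0 := barrier_level D r c y h.
Context (y_le : r / (4 * c) <= - y) {x : R} (xD : 0 <= x <= D).
Context {alpha : (R -> R) * (R -> R) -> R -> R}
  (alpha_barrier : barrier_strategy D y x beta0 alpha).

Let c_gt0 : 0 < c.
Proof. by rewrite invr_gt0 addr_gt0 ?invr_gt0. Qed.

Let spec := barrier_level_spec D_gt0 r_gt0 c_gt0 h_cont h0 y_le.

Let alpha_incr psi : cont_paths2 psi -> incr_paths (alpha psi).
Proof. by case: alpha_barrier => -[[+ _] _] _; apply. Qed.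

Lemma energy0 psi : energy c1 c2 0 psi = 0%E.
Proof.
rewrite /energy; case: asboolP => [_|]; first by rewrite set_itv1 integral_set1.
move=> nac; exfalso; apply: nac; split; apply: (@lipschitz_abs_continuous _ _ _ 0) => //.
- move=> u v u0 uv v0; have -> : u = v by apply/eqP; rewrite eq_le uv (le_trans v0).
  by rewrite !subrr normr0 mulr0.
- move=> u v u0 uv v0; have -> : u = v by apply/eqP; rewrite eq_le uv (le_trans v0).
  by rewrite !subrr normr0 mulr0.
Qed.

(** The initial jump of size x ends the game at time 0, so every path costs exactly r x; the zero
    path shows that the supremum is over a nonempty set. *)
Lemma game_value_barrier0 : beta0 = 0 ->
  game_value r c1 c2 y h x alpha = (value_function D r c y h x)%:E.
Proof.
move=> b0; have [_] := alpha_barrier; rewrite b0 eqxx => alphax.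
have tr0 psi : cont_paths2 psi -> trajectory y x psi (alpha psi) 0 = 0.
  move=> cpsi; rewrite /trajectory /free_path alphax//.
  by case: cpsi => -[_ ->] [_ ->]; ring.
have hit0 psi : cont_paths2 psi -> hitting_time y x psi (alpha psi) = 0%E.
  move=> cpsi; apply/eqP; rewrite eq_le hitting_time_ge0 andbT.
  by apply: hitting_time_le => //; exact: tr0.
have cost psi : cont_paths2 psi -> game_cost r c1 c2 y h x psi (alpha psi) = (r * x)%:E.
  move=> cpsi; rewrite /game_cost hit0//= energy0 alphax// set_itv1 integral_set1.
  by rewrite add0e sube0.
have vE : value_function D r c y h x = r * x.
  rewrite /value_function -/beta0 b0; case: ifPn => [x0|_].
    have -> : x = 0 by apply/eqP; rewrite eq_le x0; case/andP: xD.
    by rewrite set_itv1 Rintegral_set1 mulr0.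
  by rewrite set_itv1 Rintegral_set1 subr0 add0r.
rewrite vE /game_value; apply/eqP; rewrite eq_le; apply/andP; split.
  by apply: ge_ereal_sup => _ [psi [cpsi _] <-]; rewrite cost.
have cpsi : cont_paths2 ((fun=> 0), (fun=> 0) : R -> R).
  by split; split => //=; apply: continuous_subspaceT; exact: cst_continuous.
apply: ereal_sup_ubound; exists ((fun=> 0), (fun=> 0)); last exact: cost.
by split => //; rewrite /= hit0// ltry.
Qed.

Context (beta0_neq0 : beta0 != 0).

Lemma game_cost_le psi : hitting_paths y x alpha psi ->
  (game_cost r c1 c2 y h x psi (alpha psi) <= (value_function D r c y h x)%:E)%E.
Proof.
move=> hit; have [cpsi fin] := hit.
have [_] := alpha_barrier; rewrite (negbTE beta0_neq0) => /(_ _ hit).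
move=> [phi [eta1 [eta2 [[neg phiw phiI null1 null2] H]]]].
rewrite /game_cost; set T := fine _.
have TE : T%:E = hitting_time y x psi (alpha psi) := hitting_time_fineK fin.
have T0 : 0 <= T by rewrite -lee_fin TE hitting_time_ge0.
have HT t : 0 <= t <= T -> [/\ trajectory y x psi (alpha psi) t = phi t, eta1 t = 0
    & alpha psi t = eta2 t].
  by move=> /andP[t0 tT]; apply: H => //; rewrite -TE lee_fin.
(* Infinite energy makes the cost -oo. Finite energy yields absolute continuity. *)
have [->|/eqP enoo] := pselect (energy c1 c2 T psi = +oo%E).
  by rewrite addeNy leNye.
have {}enoo : (energy c1 c2 T psi < +oo)%E by rewrite ltey.
have [ac1 ac2] : abs_continuous 0 T psi.1 /\ abs_continuous 0 T psi.2.
  by move: enoo; rewrite /energy; case: asboolP.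
have [e [e0 eT eE]] : exists e : R -> R, [/\ e 0 = 0, ((e T)%:E <= energy c1 c2 T psi)%E &
    forall p u v, 0 <= u -> u <= v -> v <= T ->
      p * ((psi.1 v - psi.2 v) - (psi.1 u - psi.2 u)) - p ^+ 2 / (4 * c) * (v - u)
      <= e v - e u].
  move: (T0); rewrite le_eqVlt => /orP[/eqP T00|Tgt0]; last exact: energy_lower.
  exists (fun=> 0); split => //; first by rewrite -T00 energy0.
  move=> p u v u0 uv vT; have -> : u = v.
    by apply/eqP; rewrite eq_le uv (le_trans vT)// -T00.
  by rewrite !subrr !mulr0 subrr.
have [[cpsi1 psi10] [cpsi2 psi20]] := cpsi.
have cw : {within `[0, T], continuous (free_path y x psi)}.
  have sub : `[0, T] `<=` `[0, +oo[%classic.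
    by move=> t; rewrite /= !in_itv/= andbT => /andP[].
  have c1T := continuous_subspaceW sub cpsi1.
  have c2T := continuous_subspaceW sub cpsi2.
  have cl : {within `[0, T], continuous (fun t : R => x + y * t)}.
    apply: continuous_subspaceT => t.
    by apply: cvgD; [exact: cvg_cst|apply: cvgMr; exact: cvg_id].
  move=> t; apply: cvgB; last exact: c2T.
  by apply: cvgD; [exact: cl|exact: c1T].
have w0 : free_path y x psi 0 = x by rewrite /free_path psi10 psi20; ring.
have phiE u : 0 <= u <= T -> phi u = free_path y x psi u - eta2 u.
  move=> uT; have [_ e10 _] := HT u uT; have /andP[u0 _] := uT.
  by rewrite phiw// e10 addr0.
have eE' p u v : 0 <= u -> u <= v -> v <= T ->
     p * ((free_path y x psi v - y * v) - (free_path y x psi u - y * u))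
     - p ^+ 2 / (4 * c) * (v - u) <= e v - e u.
  move=> u0 uv vT; apply: le_trans (eE p u v u0 uv vT).
  by rewrite lerD2r le_eqVlt /free_path; apply/orP; left; apply/eqP; ring.
have eta20 u : u < 0 -> eta2 u = 0 by move=> /neg[].
have main := cost_upper_bound_ereal D_gt0 r_gt0 c_gt0 h_cont h_incr h_ge0 h0 y_le
   T0 eta20 phiI null2 w0 cw phiE e0 eE'.
apply: le_trans main.
have TT : 0 <= T <= T by rewrite T0 lexx.
have [_ _ ->] := HT T TT.
rewrite (_ : \int[lebesgue_measure]_(t in `[0%R, T]) _ =
  \int[lebesgue_measure]_(t in `[0%R, T]) (h (phi t))%:E)%E; last first.
  apply: eq_integral => t; rewrite inE/= in_itv/= => tT.
  by have [-> _ _] := HT t tT.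
by apply: leeB.
Qed.

Lemma game_cost_ge d : 0 < d -> exists2 psi, hitting_paths y x alpha psi &
  ((value_function D r c y h x - c * d * D)%:E <=
    game_cost r c1 c2 y h x psi (alpha psi))%E.
Proof.
move=> d0; have [b_ge0 bD hb] := spec.
have b_gt0 : 0 < beta0 by rewrite lt_neqAle eq_sym beta0_neq0.
(* z is the position after the initial jump and J the size of the jump. *)
pose z := Num.min x beta0; pose J := x - z.
have /andP[x0 x_le] := xD.
have zb : 0 <= z <= beta0 by rewrite le_min x0 b_ge0 ge_min lexx orbT.
have /andP[z0 zb'] := zb.
have J0 : 0 <= J by rewrite subr_ge0 ge_min lexx.
have [phi [T [T' [cphi phi0 [T0 phiT T'0 phiT'] [phi_lt phi_gt] [cv dphi lip cost]]]]] :=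
  near_optimal_path D_gt0 r_gt0 c_gt0 h_cont h_incr h_ge0 h0 y_le d0 zb J0.
set v := (fun t => - _) in cv dphi cost.
pose m t := phi t - z - y * t.
(* The cheapest splitting with psi.1 - psi.2 = m; its energy density is c times the square of the
   derivative of m. *)
pose psi := ((fun t => c / c1 * m t), (fun t => - (c / c2 * m t))).
have cm : continuous m.
  move=> t; apply: cvgB; first by apply: cvgB; [exact: cphi|exact: cvg_cst].
  by apply: cvgMr; exact: cvg_id.
have m0 : m 0 = 0 by rewrite /m phi0; ring.
have cpsi : cont_paths2 psi.
  split; split; rewrite /= ?m0 ?mulr0 ?oppr0//; apply: continuous_subspaceT => t.
    by apply: cvgMr; exact: cm.
  by apply: cvgN; apply: cvgMr; exact: cm.
have csplit : c / c1 + c / c2 = 1.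
  by rewrite -mulrDr mulVf// gt_eqF// addr_gt0// invr_gt0.
have free t : free_path y x psi t = J + phi t.
  rewrite /free_path /= opprK -addrA -mulrDl csplit mul1r /m /J; ring.
have [adm] := alpha_barrier; rewrite (negbTE beta0_neq0) => bar.
have [a_ge0 a_mono a_cad] := alpha_incr psi cpsi.
(* At T' the unreflected path equals -1 and [alpha psi] only pushes down; without a hit,
   admissibility would keep the trajectory nonnegative. *)
have fin : (hitting_time y x psi (alpha psi) < +oo)%E.
  rewrite ltey; apply/eqP => infty.
  have := adm.2 psi cpsi T' T'0; rewrite infty leey => /(_ isT) /andP[tr0 _].
  by move: tr0; rewrite /trajectory free phiT'; have := a_ge0 T' T'0; lra.
have hit : hitting_paths y x alpha psi by split.
exists psi => //.
have [phi' [eta1 [eta2 [[neg phiw phiI null1 null2] H]]]] := bar psi hit.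
rewrite /game_cost; set S := fine _.
have SE : S%:E = hitting_time y x psi (alpha psi) := hitting_time_fineK fin.
have S0 : 0 <= S by rewrite -lee_fin SE hitting_time_ge0.
have HS t : 0 <= t -> t <= S ->
    trajectory y x psi (alpha psi) t = J + phi t - eta2 t /\ alpha psi t = eta2 t.
  move=> t0 tS; have [|trE e10 ->] := H t t0; first by rewrite -SE lee_fin.
  by rewrite trE phiw// free e10 addr0.
have phi'E t : 0 <= t -> t <= S -> phi' t = J + phi t - eta2 t.
  move=> t0 tS; have [|_ e10 _] := H t t0; first by rewrite -SE lee_fin.
  by rewrite phiw// free e10 addr0.
have eta20 u : u < 0 -> eta2 u = 0 by move=> /neg[].
have nd := cumulative_is_nondecreasing eta2.
have e2ge0 : 0 <= eta2 0 by have := nd (-1) 0 (lerN10 _); rewrite eta20 ?ltrN10.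
have etaJ : eta2 0 = J.
  have /andP[p0 pb] := phiI 0 (lexx _).
  have pE := phi'E 0 (lexx _) S0; rewrite phi0 in pE.
  move: e2ge0; rewrite le_eqVlt => /orP[/eqP e00|egt].
    by move: pb; rewrite pE -e00 subr0 /J subrK => xb; rewrite /z min_l// subrr.
  have [||||w [w1 w0 w0' ew pw]] :=
    @reflection_growth R beta0 phi' eta2 0 (-1) 0 eta20 phiI null2.
  - by [].
  - by rewrite lerN10.
  - by rewrite eta20 ?ltrN10.
  - exact: egt.
  have wE : w = 0 by apply/eqP; rewrite eq_le w0 w0'.
  rewrite wE pE in pw; have eE : eta2 0 = x - beta0.
    by rewrite -pw /J; ring.
  by rewrite eE /J /z min_r// -subr_ge0 -eE ltW.
(* Growth beyond J needs a later contact w with eta2 w > J, hence phi w > beta0 >= z, whereas phi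
   stays below z after time 0. *)
have eta_cst t : 0 <= t -> t <= S -> t <= T -> eta2 t = J.
  move=> t0 tS tT; apply/eqP; rewrite eq_le -{2}etaJ nd// andbT leNgt; apply/negP => Jt.
  have [||||w [w1 wt w0 ew pw]] :=
    @reflection_growth R beta0 phi' eta2 J 0 t eta20 phiI null2.
  - exact: J0.
  - exact: t0.
  - by rewrite etaJ.
  - exact: Jt.
  have := phi_lt w w1 (le_trans wt tT).
  rewrite phi'E ?(le_trans wt tS)// in pw.
  by move: pw ew zb'; lra.
have trE t : 0 <= t -> t <= S -> t <= T -> trajectory y x psi (alpha psi) t = phi t.
  by move=> t0 tS tT; have [-> _] := HS t t0 tS; rewrite eta_cst//; ring.
have ST : S = T.
  apply/eqP; rewrite eq_le; apply/andP; split.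
    have [TS|/ltW//] := leP T S.
    rewrite -lee_fin SE; apply: hitting_time_le => //.
    by rewrite trE.
  rewrite leNgt; apply/negP => lt.
  have := phi_gt S S0 lt; rewrite -trE// ?ltW//.
  by rewrite trajectory_hitting_time ?ltxx//; exact: alpha_incr.
have vT t : 0 < t < T -> is_derive t 1 m (v t - y).
  move=> tT; have dp := dphi t tT.
  have dz : is_derive t 1 (fun=> z) 0 by exact: is_derive_cst.
  have dy : is_derive t 1 (fun s => y * s) y.
    have := @is_deriveZ R R R id y t 1 1 (is_derive_id t 1).
    by rewrite /GRing.scale/= mulr1.
  by have := is_deriveB (is_deriveB dp dz) dy; rewrite subr0.
have d1 t : 0 < t < T -> derive1 psi.1 t = c / c1 * (v t - y).
  move=> tT; rewrite derive1E.
  by have [_] := @is_deriveZ R R R m (c / c1) t 1 (v t - y) (vT t tT).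
have d2 t : 0 < t < T -> derive1 psi.2 t = - (c / c2 * (v t - y)).
  move=> tT; rewrite derive1E.
  by have [_] := is_deriveN (@is_deriveZ R R R m (c / c2) t 1 (v t - y) (vT t tT)).
have int0T (f : R -> R) : continuous f -> lebesgue_measure.-integrable `[0, T] (EFin \o f).
  move=> cf; apply: continuous_compact_integrable; first exact: segment_compact.
  exact: continuous_subspaceT.
have m0T : measurable (`[0, T]%classic : set (measurableTypeR R)) by exact: measurable_itv.
have lipm u w : 0 <= u -> u <= w -> w <= T -> `|m w - m u| <= (d - y - y) * (w - u).
  move=> u0 uw wT; rewrite /m.
  have -> : phi w - z - y * w - (phi u - z - y * u) = (phi w - phi u) - y * (w - u) by ring.
  apply: le_trans (ler_normB _ _) _; rewrite normrM (ger0_norm (_ : 0 <= w - u)) ?subr_ge0//.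
  rewrite (ltr0_norm (y_lt0 r_gt0 c_gt0 y_le)) mulrBl; apply: lerD; first exact: lip.
  by rewrite mulNr.
have K0 : 0 <= d - y - y by have := y_lt0 r_gt0 c_gt0 y_le; lra.
have lipZ k u w : 0 <= u -> u <= w -> w <= T ->
    `|k * m w - k * m u| <= (`|k| * (d - y - y)) * (w - u).
  by move=> u0 uw wT; rewrite -mulrBr normrM -mulrA ler_wpM2l// lipm.
have ac : abs_continuous 0 T psi.1 /\ abs_continuous 0 T psi.2.
  split.
    apply: (@lipschitz_abs_continuous _ _ _ (`|c / c1| * (d - y - y))).
      by rewrite mulr_ge0.
    exact: lipZ.
  apply: (@lipschitz_abs_continuous _ _ _ (`|- (c / c2)| * (d - y - y))).
    by rewrite mulr_ge0.
  by move=> u w u0 uw wT; have := lipZ (- (c / c2)) u w u0 uw wT; rewrite !mulNr.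
have cen : continuous (fun t => c * (v t - y) ^+ 2).
  move=> t; apply: cvgMr.
  apply: (@continuous_comp _ _ _ (fun t => v t - y) (fun a => a ^+ 2)).
    by apply: cvgB; [exact: cv|exact: cvg_cst].
  exact: exprn_continuous.
have enE : energy c1 c2 T psi =
    (\int[lebesgue_measure]_(t in `[0, T]) (c * (v t - y) ^+ 2))%:E.
  rewrite /energy asboolT// /Rintegral fineK; last first.
    by have := integrable_fin_num m0T (int0T _ cen).
  set F := (fun s => _%:E).
  (* The derivatives are known only on the open interval; both integrals drop their endpoints
     below. *)
  have FG : {in `]0, T[%classic, F =1 (fun t => (c * (v t - y) ^+ 2)%:E)}.
    move=> t; rewrite inE/= in_itv/= => tT; rewrite /F d1// d2//; congr EFin.
    transitivity (c * (c / c1 + c / c2) * (v t - y) ^+ 2); last by rewrite csplit mulr1.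
    by field; rewrite !gt_eqF.
  have mG : measurable_fun `]0, T[%classic (fun t : R => (c * (v t - y) ^+ 2)%:E).
    apply/measurable_EFinP; apply: measurable_funTS.
    exact: continuous_measurable_fun.
  have mF : measurable_fun `]0, T[%classic F.
    by apply: eq_measurable_fun mG => t tT; rewrite FG.
  rewrite (@integral_itv_bndoo _ _ _ F true false mF).
  rewrite (@integral_itv_bndoo _ _ _ (fun t : R => (c * (v t - y) ^+ 2)%:E) true false mG).
  exact: eq_integral.
rewrite ST enE.
have hE : (\int[lebesgue_measure]_(t in `[0%R, T]) (h (trajectory y x psi (alpha psi) t))%:E
    = (\int[lebesgue_measure]_(t in `[0, T]) h (phi t))%R%:E)%E.
  have chk : continuous (fun t => h (clip 0 D (phi t))).
    move=> t; apply: (@continuous_comp _ _ _ phi (h \o clip 0 D)); first exact: cphi.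
    exact: continuous_comp_clip (ltW D_gt0) h_cont _.
  have phiD t : 0 <= t <= T -> 0 <= phi t <= D.
    move=> /andP[t0 tT]; apply/andP; split.
      by move: tT; rewrite le_eqVlt => /orP[/eqP ->|/(phi_gt t t0)/ltW//]; rewrite phiT.
    apply: le_trans bD; apply: le_trans zb'.
    by move: t0; rewrite le_eqVlt => /orP[/eqP <-|/phi_lt/(_ tT)/ltW//]; rewrite phi0.
  rewrite /Rintegral fineK; last first.
    have := integrable_fin_num m0T (int0T _ chk).
    congr (_ \is a fin_num); apply: eq_integral => t; rewrite inE/= in_itv/= => tT.
    by rewrite clip_id// phiD.
  apply: eq_integral => t; rewrite inE/= in_itv/= => /andP[t0 tT].
  by rewrite trE// ST.
have aT : alpha psi T = J.
  have TS : T <= S by rewrite ST.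
  by have [_ ->] := HS T T0 TS; rewrite eta_cst.
rewrite hE aT -!EFinD lee_fin.
have vE : value_function D r c y h x = @g_low R c y h z + r * J.
  rewrite /value_function -/beta0; have [xb|bx] := leP x beta0.
    by rewrite /J /z min_l// subrr mulr0 addr0.
  by rewrite /J /z min_r// ltW.
have zD : c * d * z <= c * d * D.
  by rewrite ler_wpM2l ?mulr_ge0 ?(ltW c_gt0) ?(ltW d0)// (le_trans zb').
have combine (g E E' I I' k : R) : E <= E' -> g - E <= I - I' ->
    g + k - E' <= I + k - I' by lra.
by rewrite vE; exact: combine zD cost.
Qed.

Lemma game_value_barrier :
  game_value r c1 c2 y h x alpha = (value_function D r c y h x)%:E.
Proof.
apply/eqP; rewrite eq_le; apply/andP; split.
  by apply: ge_ereal_sup => _ [psi hit <-]; exact: game_cost_le.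
apply/lee_addgt0Pr => e e0.
(* With d = e / (c D) the loss c d D is exactly e. *)
have d0 : 0 < e / (c * D) by rewrite divr_gt0// mulr_gt0.
have [psi hit le_cost] := game_cost_ge _ d0.
rewrite -leeBlDr//; apply: le_trans (ereal_sup_ubound _); last by exists psi.
apply: le_trans le_cost.
have -> : c * (e / (c * D)) * D = e by field; rewrite !gt_eqF.
by rewrite EFinB.
Qed.

End Game.

Theorem theorem3p3 (R : realType) (D r c1 c2 y : R) (h : R -> R)
    (D_gt0 : 0 < D) (r_gt0 : 0 < r) (c1_gt0 : 0 < c1) (c2_gt0 : 0 < c2)
    (h_cont : {within `[0, D], continuous h})
    (h_incr : forall u v : R, 0 <= u -> u < v -> v <= D -> h u < h v)
    (h_ge0 : forall u : R, 0 <= u <= D -> 0 <= h u)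
    (h0 : h 0 = 0) :
  let c := (c1^-1 + c2^-1)^-1 in
  let beta0 := barrier_level D r c y h in
  r / (4 * c) <= - y ->
  forall x : R, 0 <= x <= D ->
  forall alpha : (R -> R) * (R -> R) -> R -> R,
    barrier_strategy D y x beta0 alpha ->
    (value_function D r c y h x)%:E = game_value r c1 c2 y h x alpha.
Proof.
move=> c beta0 y_le x xD alpha barrier; apply/esym.
have [b0|b0] := eqVneq beta0 0; first exact: game_value_barrier0.
exact: game_value_barrier.
Qed.
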